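(* Let $(\mathcal{A}_i)_{i\in I}$ be a family of relational structures whose universes are given by unary predicates $P_i$, $i\in I$, and let $\mathcal{A}_P={\rm Comb}_P(\mathcal{A}_i)_{i\in I}$ be their $P$-combination. If the predicates $P_i$ are pairwise disjoint, the languages $\Sigma(\mathcal{A}_i)$, $i\in I$, are at most countable, and the structure $\mathcal{A}_P$ is infinite, then the theory ${\rm Th}(\mathcal{A}_P)$ is Ehrenfeucht if and only if the following conditions hold: (a) $I$ is finite; (b) each structure $\mathcal{A}_i$ is either finite, or $\omega$-categorical, or Ehrenfeucht; (c) some $\mathcal{A}_i$ is Ehrenfeucht.
   Context: All languages are relational. Let $P=(P_i)_{i\in I}$ be a family of nonempty unary predicates and $(\mathcal{A}_i)_{i\in I}$ a family of structures such that $P_i$ is the universe of $\mathcal{A}_i$ and the symbols $P_i$ do not belong to the languages $\Sigma(\mathcal{A}_j)$, $j\in I$. The $P$-union $\mathcal{A}_P$ is the union $\bigcup_{i\in I}\mathcal{A}_i$ (universe: union of the universes; each relation symbol interpreted by the union of its interpretations in the $\mathcal{A}_i$, where a symbol missing from $\Sigma(\mathcal{A}_i)$ is interpreted in $\mathcal{A}_i$ by the empty relation), expanded by the predicates $P_i$. It is called the $P$-combination ${\rm Comb}_P(\mathcal{A}_i)_{i\in I}$ if $\mathcal{A}_i=(\mathcal{A}_P\upharpoonright A_i)\upharpoonright\Sigma(\mathcal{A}_i)$ for all $i\in I$, where $A_i$ is the universe of $\mathcal{A}_i$. $I(T,\lambda)$ denotes the number of pairwise non-isomorphic models of $T$ of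 cardinality $\lambda$. A theory $T$ is Ehrenfeucht if $1<I(T,\omega)<\omega$ (finitely many countable models, but not $\omega$-categorical). A structure is Ehrenfeucht (respectively, an infinite structure is $\omega$-categorical) if its theory is. *)

(* Defs.v *)
From mathcomp Require Import all_boot.
From mathcomp Require Import boolp classical_sets cardinality.

Set Implicit Arguments.
Unset Strict Implicit.
Unset Printing Implicit Defensive.

Local Open Scope classical_set_scope.
Local Open Scope card_scope.

(** * First-order logic with equality over a relational signature *)

Record signature := Signature { symbol : Type; arity : symbol -> nat }.

(* [formula L n] has its free variables among ['I_n]; [FAll] binds variable
   [ord0] and shifts the others.  The remaining connectives and the existential
   quantifier are definable, the semantics below being classical. *)
Inductive formula (L : signature) (n : nat) : Type :=
| FFalse
| FEq (x y : 'I_n)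
| FRel (s : symbol L) (x : 'I_(arity s) -> 'I_n)
| FImp (phi psi : formula L n)
| FAll (phi : formula L n.+1).

Definition sentence (L : signature) := formula L 0.

Record structure (L : signature) := Structure {
  carrier :> Type;
  rel : forall s : symbol L, set ('I_(arity s) -> carrier) }.

Definition env_cons (X : Type) (n : nat) (x : X) (e : 'I_n -> X) :
    'I_n.+1 -> X :=
  fun i => oapp e x (unlift ord0 i).

Fixpoint sat (L : signature) (M : structure L) (n : nat) (phi : formula L n) :
    ('I_n -> M) -> Prop :=
  match phi in formula _ _ return ('I_n -> M) -> Prop with
  | FFalse => fun=> False
  | FEq x y => fun e => e x = e y
  | FRel s x => fun e => rel (e \o x)
  | FImp phi psi => fun e => sat phi e -> sat psi e
  | FAll phi => fun e => forall a : M, sat phi (env_cons a e)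
  end.

Definition env_nil (X : Type) : 'I_0 -> X :=
  fun i => False_rect X (notF (ltn_ord i)).

Definition holds (L : signature) (M : structure L) (phi : sentence L) : Prop :=
  sat phi (@env_nil M).

Definition theory (L : signature) := set (sentence L).

Definition models (L : signature) (M : structure L) (T : theory L) : Prop :=
  forall phi, T phi -> holds M phi.

Definition Th (L : signature) (M : structure L) : theory L :=
  [set phi | holds M phi].

Definition isomorphic (L : signature) (M N : structure L) : Prop :=
  exists f : M -> N, bijective f /\
    forall (s : symbol L) (t : 'I_(arity s) -> M), rel t <-> rel (f \o t).

(* [I(T, lambda) = kappa], where the cardinals [lambda] and [kappa] are
   represented by the types [Lambda] and [K]: [K] indexes a system of
   representatives of the isomorphism classes of models of size [lambda]. *)
Definition number_of_models (L : signature) (T : theory L) (Lambda K : Type) :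
    Prop :=
  exists M : K -> structure L,
    [/\ forall k, models (M k) T /\ [set: M k] #= [set: Lambda],
        forall k l, isomorphic (M k) (M l) -> k = l
      & forall N : structure L, models N T -> [set: N] #= [set: Lambda] ->
          exists k, isomorphic N (M k)].

Definition Ehrenfeucht_theory (L : signature) (T : theory L) : Prop :=
  exists n : nat, (1 < n)%N /\ number_of_models T nat 'I_n.

Definition omega_categorical_theory (L : signature) (T : theory L) : Prop :=
  number_of_models T nat 'I_1.

Definition Ehrenfeucht (L : signature) (M : structure L) : Prop :=
  Ehrenfeucht_theory (Th M).

Definition omega_categorical (L : signature) (M : structure L) : Prop :=
  infinite_set [set: M] /\ omega_categorical_theory (Th M).

(** * Structures inside an ambient set of points and an ambient set of symbols *)

(* The members of a family of structures may share points and symbols, so each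
   one carries its own language [lang] (a subset of the symbols of [S]) and its
   own universe [univ] (a subset of [U]).  A symbol outside [lang] is
   interpreted by the empty relation. *)
Record setstructure (S : signature) (U : Type) := SetStructure {
  lang : set (symbol S);
  univ : set U;
  interp : forall s : symbol S, set ('I_(arity s) -> U);
  interp_lang : forall s (t : 'I_(arity s) -> U), interp t -> lang s;
  interp_univ : forall s (t : 'I_(arity s) -> U),
    interp t -> forall k, univ (t k) }.

Definition sublanguage (S : signature) (Sigma : set (symbol S)) : signature :=
  Signature (fun s : set_type Sigma => arity (sval s)).

Definition to_structure (S : signature) (U : Type) (A : setstructure S U) :
    structure (sublanguage (lang A)) :=
  @Structure (sublanguage (lang A)) (set_type (univ A))
    (fun s t => interp A (s := sval s) (fun k => sval (t k))).

Coercion to_structure : setstructure >-> structure.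

Section Operations.
Variables (S : signature) (U : Type).

Section Restriction.
Variables (A : setstructure S U) (X : set U).

Definition restriction_interp (s : symbol S) : set ('I_(arity s) -> U) :=
  [set t | interp A t /\ forall k, X (t k)].

Lemma restriction_lang s (t : 'I_(arity s) -> U) :
  restriction_interp t -> lang A s.
Proof. by case=> /interp_lang. Qed.

Lemma restriction_univ s (t : 'I_(arity s) -> U) :
  restriction_interp t -> forall k, (univ A `&` X) (t k).
Proof. by case=> /interp_univ At Xt k; split; [exact: At|exact: Xt]. Qed.

Definition restriction : setstructure S U :=
  SetStructure restriction_lang restriction_univ.

End Restriction.

Section Reduct.
Variables (A : setstructure S U) (Sigma : set (symbol S)).

Definition reduct_interp (s : symbol S) : set ('I_(arity s) -> U) :=
  [set t | interp A t /\ Sigma s].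

Lemma reduct_lang s (t : 'I_(arity s) -> U) :
  reduct_interp t -> (lang A `&` Sigma) s.
Proof. by case=> /interp_lang. Qed.

Lemma reduct_univ s (t : 'I_(arity s) -> U) :
  reduct_interp t -> forall k, univ A (t k).
Proof. by case=> /interp_univ. Qed.

Definition reduct : setstructure S U := SetStructure reduct_lang reduct_univ.

End Reduct.

Variables (I : Type) (P : I -> symbol S) (A : I -> setstructure S U).

(* The symbols [P i] are distinct, unary and new, and the predicates they
   denote, i.e. the universes of the [A i], are nonempty. *)
Definition universe_predicates : Prop :=
  [/\ injective P,
      forall i, arity (P i) = 1%N,
      forall i j, ~ lang (A j) (P i)
    & forall i, univ (A i) !=set0].

(* As [P i] is unary, [forall k, univ (A i) (t k)] says that the only entry of
   [t] is in the universe of [A i]. *)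
Definition P_union_interp (s : symbol S) : set ('I_(arity s) -> U) :=
  [set t | (exists i, interp (A i) t) \/
           (exists i, s = P i /\ forall k, univ (A i) (t k))].

Lemma P_union_lang s (t : 'I_(arity s) -> U) :
  P_union_interp t -> ((\bigcup_i lang (A i)) `|` range P) s.
Proof.
case=> [[i /interp_lang Ai]|[i [sP _]]]; first by left; exists i.
by right; exists i.
Qed.

Lemma P_union_univ s (t : 'I_(arity s) -> U) :
  P_union_interp t -> forall k, (\bigcup_i univ (A i)) (t k).
Proof.
by case=> [[i /interp_univ Ai]|[i [_ Ai]]] k; exists i => //; exact: Ai.
Qed.

Definition P_union : setstructure S U := SetStructure P_union_lang P_union_univ.

Definition is_P_combination : Prop :=
  forall i, A i = reduct (restriction P_union (univ (A i))) (lang (A i)).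

End Operations.

(* Main.v *)
Require Import Defs.
From mathcomp Require Import all_boot.
From mathcomp Require Import boolp classical_sets functions cardinality filter.

(** The proof compares structures by Ehrenfeucht-Fraisse games ([EF]): two
    structures are elementarily equivalent if and only if the duplicator wins
    every game with finitely many rounds and finitely many symbols
    ([models_Th_EF]).

    Assume that [I] is finite. In a model of the theory of the combination the
    predicates cut out, by restriction of games, models of the theories of the
    [A i] ([model_component]), and these components determine the model up to
    isomorphism ([components_isomorphic]). Conversely strategies for the members
    can be played side by side, so a disjoint union of models of the theories of
    the [A i] is a model of the theory of the combination, with the expected
    components ([disjoint_union_models], [component_disjoint_union]). Up to
    isomorphism a countable model is thus a choice, for each infinite [A i], of a
    countable model of its theory, a finite [A i] being determined by its theory
    ([finite_models_isomorphic]). So the combination has finitely many countable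
    models exactly when every infinite [A i] does, and at least two exactly when
    some [A i] has at least two.

    It remains to exclude that [I] is infinite. A countable model has a point in
    each of the pairwise disjoint parts, so [I] and the language of the
    combination are countable. An ultrapower provides points [c 0], [c 1] and so
    on outside all the parts and in pairwise different connected components, for
    the adjacency given by all the relations ([disconnected_points]); the downward
    Lowenheim-Skolem theorem makes the model countable. Keep only the parts and
    the components of [c 0], ..., [c (k - 1)]. This is an elementary substructure
    ([tarski_vaught_parts]): a point [a] witnessing a formula and not connected
    to its parameters can be replaced with a point [a'] of the same type, up to
    finitely many rounds and symbols, in a part that contains no parameter, since
    exchanging the surroundings of [a] and [a'] while fixing everything else is a
    winning strategy ([EF_swap]). Exactly [k] components of this model
    lie outside the parts, so varying [k] gives infinitely many countable models
    ([infinitely_many_models]). *)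

Set Implicit Arguments.
Unset Strict Implicit.
Unset Printing Implicit Defensive.

Local Open Scope classical_set_scope.
Local Open Scope card_scope.
Local Notation rel := Defs.rel.

(** * Formulas and finite conjunctions *)

Section Connectives.
Variable L : signature.

Definition fnot n (phi : formula L n) := FImp phi (FFalse L n).
Definition fand n (phi psi : formula L n) := fnot (FImp phi (fnot psi)).
Definition fex n (phi : formula L n.+1) : formula L n := fnot (FAll (fnot phi)).
Definition fbig n (K : finType) (phi : K -> formula L n) :=
  foldr (fun k psi => fand (phi k) psi) (fnot (FFalse L n)) (enum K).

Lemma sat_fand n (M : structure L) (phi psi : formula L n) (e : 'I_n -> M) :
  sat (fand phi psi) e <-> sat phi e /\ sat psi e.
Proof.
rewrite /=; split=> [h|[hphi hpsi] /(_ hphi)]; last by apply.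
by split; apply: contrapT => hn; apply: h => // /hn.
Qed.

Lemma sat_fex n (M : structure L) (phi : formula L n.+1) (e : 'I_n -> M) :
  sat (fex phi) e <-> exists a, sat phi (env_cons a e).
Proof.
rewrite /=; split=> [h|[a ha] /(_ a)]; last by apply.
by apply: contrapT => hn; apply: h => a ha; apply: hn; exists a.
Qed.

Lemma sat_fbig n (K : finType) (M : structure L) (phi : K -> formula L n)
    (e : 'I_n -> M) :
  sat (fbig phi) e <-> forall k, sat (phi k) e.
Proof.
suff h s : sat (foldr (fun k psi => fand (phi k) psi)
    (fnot (FFalse L n)) s) e <-> forall k, k \in s -> sat (phi k) e.
  by rewrite h; split=> hK k //; apply: hK; rewrite mem_enum.
elim: s => [|k s IH]; first by split=> [_ k|_ []].
rewrite [foldr _ _ _]/= sat_fand IH; split=> [[hk hs] j|h].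
  by rewrite inE => /orP[/eqP->|/hs].
by split=> [|j js]; apply: h; rewrite inE ?eqxx ?js ?orbT.
Qed.

End Connectives.

Lemma finite_set_enum (T : Type) (A : set T) : finite_set A ->
  exists n (f : 'I_n -> T), forall x, A x -> exists k, f k = x.
Proof.
move=> /(@finite_seqP {classic T})[s ->].
exists (size s), (tnth (in_tuple s)); rewrite /mkset.
change (forall x : {classic T}, x \in s -> exists k, tnth (in_tuple s) k = x).
move=> x xs.
have hx : (index x s < size s)%N by rewrite index_mem.
by exists (Ordinal hx); rewrite (tnth_nth x) /= nth_index.
Qed.

(** * Ehrenfeucht-Fraisse games *)

Section Games.
Variable L : signature.
Implicit Types (M N O : structure L) (F : set (symbol L)).

Definition atomic_agree M N F (R : M -> N -> Prop) :=
  (forall a b a' b', R a b -> R a' b' -> (a = a' <-> b = b')) /\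
  (forall s, F s -> forall (t : 'I_(arity s) -> M) (u : 'I_(arity s) -> N),
     (forall k, R (t k) (u k)) -> rel t <-> rel u).

Definition extend (X Y : Type) (R : X -> Y -> Prop) a b : X -> Y -> Prop :=
  fun x y => R x y \/ x = a /\ y = b.

Definition flip_rel (X Y : Type) (R : X -> Y -> Prop) : Y -> X -> Prop :=
  fun y x => R x y.

(** [EF F q R]: the duplicator survives [q] more rounds of the game on [M] and
    [N], restricted to the symbols in [F], from the position [R], the relation
    between the points of [M] and [N] chosen so far. A relation rather than two
    tuples makes restrictions, unions and composites of positions immediate.
    The atomic condition is imposed at every stage: two empty structures allow no
    move, yet may differ on a nullary symbol. *)
Fixpoint EF M N F q (R : M -> N -> Prop) : Prop :=
  atomic_agree F R /\
  if q is q'.+1 then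
    (forall a, exists b, EF F q' (extend R a b)) /\
    (forall b, exists a, EF F q' (extend R a b))
  else True.

Lemma EF_atomic M N F q (R : M -> N -> Prop) : EF F q R -> atomic_agree F R.
Proof. by case: q => [|q] []. Qed.

Lemma extend_sub (X Y : Type) (R R' : X -> Y -> Prop) a b :
  (forall x y, R x y -> R' x y) ->
  forall x y, extend R a b x y -> extend R' a b x y.
Proof. by move=> h x y [/h|]; [left|right]. Qed.

Lemma EF_sub M N F F' q (R R' : M -> N -> Prop) :
  F' `<=` F -> (forall x y, R' x y -> R x y) -> EF F q R -> EF F' q R'.
Proof.
move=> hF; elim: q R R' => [|q IH] R R' hR [[heq hrel] hq].
  split=> //; split=> [a b a' b' /hR h /hR h'|s /hF Fs t u h]; first exact: heq.
  by apply: hrel => // k; apply: hR.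
split; first split=> [a b a' b' /hR h /hR h'|s /hF Fs t u h]; first exact: heq.
  by apply: hrel => // k; apply: hR.
by case: hq => h1 h2; split=> [a|b];
  [have [b hb] := h1 a; exists b|have [a hb] := h2 b; exists a];
  apply: IH hb; apply: extend_sub.
Qed.

Lemma EF_leq M N F q q' (R : M -> N -> Prop) :
  (q' <= q)%N -> EF F q R -> EF F q' R.
Proof.
elim: q q' R => [|q IH] [|q'] R // hq h; first by split=> //; apply: EF_atomic h.
case: h => hat [h1 h2]; split=> //; split=> [a|b].
  by have [b hb] := h1 a; exists b; apply: IH hb.
by have [a ha] := h2 b; exists a; apply: IH ha.
Qed.

Lemma EF_flip M N F q (R : M -> N -> Prop) : EF F q R -> EF F q (flip_rel R).
Proof.
elim: q R => [|q IH] R [[heq hrel] hq].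
  split=> //; split=> [a b a' b' h h'|s Fs t u h].
    by split=> /(heq _ _ _ _ h h').
  by split=> /(hrel s Fs u t h).
split; first split=> [a b a' b' h h'|s Fs t u h].
- by split=> /(heq _ _ _ _ h h').
- by split=> /(hrel s Fs u t h).
case: hq => h1 h2; split=> [a|b]; [have [b hb] := h2 a; exists b
  |have [a hb] := h1 b; exists a];
  by apply: EF_sub (IH _ hb) => // x y [h|[-> ->]]; [left|right].
Qed.

Definition comp_rel (X Y Z : Type) (R : X -> Y -> Prop) (S : Y -> Z -> Prop) :
  X -> Z -> Prop := fun x z => exists2 y, R x y & S y z.

Lemma EF_trans M N O F q (R : M -> N -> Prop) (S : N -> O -> Prop) :
  EF F q R -> EF F q S -> EF F q (comp_rel R S).
Proof.
elim: q R S => [|q IH] R S [[he hr] hq] [[he' hr'] hq'].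
all: split; first split=> [a c a' c' [b h1 h2] [b' h1' h2']|s Fs t u h];
  [by rewrite (he _ _ _ _ h1 h1') (he' _ _ _ _ h2 h2')| |].
- have [v hv] := choice (fun k => let: ex_intro2 y h1 h2 := h k in
    ex_intro (fun y => R (t k) y /\ S y (u k)) y (conj h1 h2)).
  by rewrite (hr s Fs t v) ?(hr' s Fs v u) // => k; case: (hv k).
- by [].
- have [v hv] := choice (fun k => let: ex_intro2 y h1 h2 := h k in
    ex_intro (fun y => R (t k) y /\ S y (u k)) y (conj h1 h2)).
  by rewrite (hr s Fs t v) ?(hr' s Fs v u) // => k; case: (hv k).
case: hq hq' => [h1 h2] [h1' h2']; split=> [a|c].
  have [b hb] := h1 a; have [c hc] := h1' b; exists c.
  apply: EF_sub (IH _ _ hb hc) => // x y [[z xz zy]|[-> ->]].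
    by exists z; left.
  by exists b; right.
have [b hb] := h2' c; have [a ha] := h2 b; exists a.
apply: EF_sub (IH _ _ ha hb) => // x y [[z xz zy]|[-> ->]].
  by exists z; left.
by exists b; right.
Qed.

Definition tuple_rel (X Y : Type) n (e : 'I_n -> X) (e' : 'I_n -> Y) :
  X -> Y -> Prop := fun x y => exists k, x = e k /\ y = e' k.

Lemma env_cons0 (X : Type) n (a : X) (e : 'I_n -> X) : env_cons a e ord0 = a.
Proof. by rewrite /env_cons unlift_none. Qed.

Lemma env_consS (X : Type) n (a : X) (e : 'I_n -> X) k :
  env_cons a e (lift ord0 k) = e k.
Proof. by rewrite /env_cons liftK. Qed.

Lemma env_cons_eta (X : Type) n (e : 'I_n.+1 -> X) :
  e = env_cons (e ord0) (fun k => e (lift ord0 k)).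
Proof.
by apply/funext => k; case: (unliftP ord0 k) => [j|] ->;
  rewrite ?env_consS ?env_cons0.
Qed.

Lemma tuple_rel_cons (X Y : Type) n (e : 'I_n -> X) (e' : 'I_n -> Y) a b x y :
  tuple_rel (env_cons a e) (env_cons b e') x y <->
  extend (tuple_rel e e') a b x y.
Proof.
split=> [[k [-> ->]]|[[k [-> ->]]|[-> ->]]].
- case: (unliftP ord0 k) => [j|] ->; rewrite ?env_consS ?env_cons0.
    by left; exists j.
  by right.
- by exists (lift ord0 k); rewrite !env_consS.
- by exists ord0; rewrite !env_cons0.
Qed.

(** Playing the entries of a tuple one after the other. *)
Lemma EF_tuple M N F n q (R : M -> N -> Prop) (t : 'I_n -> M) :
  EF F (n + q)%N R ->
  exists u : 'I_n -> N, EF F q (fun x y => R x y \/ tuple_rel t u x y).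
Proof.
elim: n R t => [|n IH] R t h.
  exists (@env_nil N).
  by apply: EF_sub h => // x y [//|[[]]].
move: h; rewrite addSn => -[_ [/(_ (t ord0))[b /IH]]].
move=> /(_ (fun k => t (lift ord0 k)))[u hu _]; exists (env_cons b u).
apply: EF_sub hu => // x y [h|]; first by left; left.
rewrite {1}(env_cons_eta t) tuple_rel_cons => -[h|h]; first by right.
by left; right.
Qed.

(** A formula involves finitely many symbols and has a finite quantifier depth. *)
Lemma EF_sat n (phi : formula L n) : exists (F : set (symbol L)) q,
  finite_set F /\
  forall M N (e : 'I_n -> M) (e' : 'I_n -> N),
    EF F q (tuple_rel e e') -> sat phi e <-> sat phi e'.
Proof.
elim: phi => {n} [n|n x y|n s x|n phi [F [q [fF h]]] psi [F' [q' [fF' h']]]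
    |n phi [F [q [fF h]]]].
- by exists set0, 0%N; split; first exact: finite_set0.
- exists set0, 0%N; split=> [|M N e e' [[he _] _]]; first exact: finite_set0.
  by apply: he; [exists x|exists y].
- exists [set s], 0%N; split=> [|M N e e' [[_ hr] _]]; first exact: finite_set1.
  by apply: hr => // k; exists (x k).
- exists (F `|` F'), (maxn q q'); split=> [|M N e e' hE]; first by rewrite finite_setU.
  have /h hphi : EF F q (tuple_rel e e').
    by apply: (EF_sub (F := F `|` F')) (EF_leq (leq_maxl q q') hE); [exact: subsetUl|].
  have /h' hpsi : EF F' q' (tuple_rel e e').
    by apply: (EF_sub (F := F `|` F')) (EF_leq (leq_maxr q q') hE); [exact: subsetUr|].
  by rewrite /= hphi hpsi.
- exists F, q.+1; split=> // M N e e' [_ [h1 h2]] /=; split=> hs.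
    move=> b; have [a ha] := h2 b.
    apply/(h M N (env_cons a e) (env_cons b e')); last exact: hs.
    by apply: EF_sub ha => // x y /tuple_rel_cons.
  move=> a; have [b hb] := h1 a.
  apply/(h M N (env_cons a e) (env_cons b e')); last exact: hs.
  by apply: EF_sub hb => // x y /tuple_rel_cons.
Qed.

Lemma atomic_agree_finite F n : finite_set F ->
  exists (K : finType) (Phi : K -> formula L n),
  forall M N (e : 'I_n -> M) (e' : 'I_n -> N),
    (forall k, sat (Phi k) e <-> sat (Phi k) e') ->
    atomic_agree F (tuple_rel e e').
Proof.
move=> fF; have [m [f hf]] := finite_set_enum fF.
exists ('I_n * 'I_n + {j : 'I_m & {ffun 'I_(arity (f j)) -> 'I_n}})%type.
exists (fun k : 'I_n * 'I_n + {j : 'I_m & {ffun 'I_(arity (f j)) -> 'I_n}} =>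
  match k with
  | inl (x, y) => FEq L x y
  | inr (existT j x) => FRel (s := f j) (fun i => x i)
  end) => M N e e' h; split.
  by move=> a b a' b' [x [-> ->]] [y [-> ->]]; apply: (h (inl (x, y))).
move=> s /hf[j <-] t u /choice[x hx].
have -> : t = e \o finfun x by apply/funext => k /=; rewrite ffunE; case: (hx k).
have -> : u = e' \o finfun x by apply/funext => k /=; rewrite ffunE; case: (hx k).
exact: (h (inr (existT _ j (finfun x)))).
Qed.

(** For a finite set of symbols there are, up to equivalence, finitely many
    formulas of each quantifier rank: a position of rank [q.+1] is described by
    saying which rank [q] descriptions are realized by a further point. *)
Lemma EF_finite F q n : finite_set F ->
  exists (K : finType) (Phi : K -> formula L n),
  forall M N (e : 'I_n -> M) (e' : 'I_n -> N),
    (forall k, sat (Phi k) e <-> sat (Phi k) e') -> EF F q (tuple_rel e e').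
Proof.
move=> fF; elim: q n => [|q IH] n; have [K0 [Phi0 h0]] := atomic_agree_finite n fF.
  by exists K0, Phi0 => M N e e' /h0.
have [K [Phi h]] := IH n.+1.
pose desc (S : {ffun K -> bool}) := fbig (fun k =>
  if S k then Phi k else fnot (Phi k)).
have forth M N (e : 'I_n -> M) (e' : 'I_n -> N) :
  (forall S, sat (fex (desc S)) e <-> sat (fex (desc S)) e') ->
  forall a, exists b, EF F q (extend (tuple_rel e e') a b).
  move=> hS a.
  pose S := [ffun k => `[< sat (Phi k) (env_cons a e) >]].
  have [b hb] : exists b, sat (desc S) (env_cons b e').
    apply/sat_fex/hS/sat_fex; exists a; apply/sat_fbig => k.
    by rewrite ffunE; case: asboolP.
  exists b; have {}h := h _ _ (env_cons a e) (env_cons b e').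
  apply: EF_sub (h _) => // [x y /tuple_rel_cons//|k].
  move/sat_fbig/(_ k): hb; rewrite ffunE.
  by case: asboolP => [ha hb|ha hb]; split=> // ?; case: hb.
exists (K0 + {ffun K -> bool})%type, (fun k => match k with
  | inl k => Phi0 k | inr T => fex (desc T) end) => M N e e' hk.
split; first by apply: h0 => k; apply: (hk (inl k)).
split=> [|b]; first by apply: forth => S; apply: (hk (inr S)).
have [a ha] := forth N M e' e (fun S => iff_sym (hk (inr S))) b.
by exists a; apply: EF_sub (EF_flip ha) => // x y [[k [? ?]]|[? ?]];
  [left; exists k|right].
Qed.

Definition empty_rel (X Y : Type) : X -> Y -> Prop := fun _ _ => False.

(** Elementary equivalence as a property of games; what follows never has to
    relativize a formula, since games can be restricted to subsets directly. *)
Lemma models_Th_EF M N : models N (Th M) <->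
  forall F q, finite_set F -> EF F q (@empty_rel M N).
Proof.
split=> [h F q fF|h phi].
  have [K [Phi hPhi]] := EF_finite q 0 fF.
  apply: EF_sub (hPhi M N (@env_nil M) (@env_nil N) _) => // k.
  split=> [|hN]; first exact: (h (Phi k)).
  by apply: contrapT => hM; exact: (h (fnot (Phi k))) hN.
have [F [q [fF hF]]] := EF_sat phi.
rewrite /Th /holds /= (hF M N (@env_nil M) (@env_nil N)) //.
by apply: EF_sub (h F q fF) => // x y [[]].
Qed.

Lemma models_Th_sym M N : models N (Th M) -> models M (Th N).
Proof.
move=> /models_Th_EF h; apply/models_Th_EF => F q fF.
exact: EF_sub (EF_flip (h F q fF)).
Qed.

Lemma models_Th_trans M N O :
  models N (Th M) -> models O (Th N) -> models O (Th M).
Proof. by move=> h h' phi /h /h'. Qed.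

Lemma EF_isomorphism M N (f : M -> N) F q (R : M -> N -> Prop) :
  bijective f ->
  (forall s (t : 'I_(arity s) -> M), rel t <-> rel (f \o t)) ->
  (forall x y, R x y -> y = f x) -> EF F q R.
Proof.
move=> [g fg gf] hf; elim: q R => [|q IH] R hR.
all: have hat : atomic_agree F R by
  split=> [a b a' b' /hR -> /hR ->|s _ t u h];
  [by split=> [->|/(can_inj fg)]
  |have -> : u = f \o t by [apply/funext => k; exact: hR]; exact: hf].
all: split=> //.
by split=> [a|b]; [exists (f a)|exists (g b)]; apply: IH => x y [/hR|[-> ->]] //;
  rewrite gf.
Qed.

Lemma isomorphic_models M N : isomorphic M N -> models N (Th M).
Proof.
move=> [f [bf hf]]; apply/models_Th_EF => F q _.
by apply: (EF_isomorphism (f := f)).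
Qed.

Lemma isomorphic_refl M : isomorphic M M.
Proof. by exists id; split=> //; exists id. Qed.

Lemma isomorphic_sym M N : isomorphic M N -> isomorphic N M.
Proof.
move=> [f [[g fg gf] hf]]; exists g; split; first by exists f.
move=> s t; rewrite hf.
by have -> : f \o (g \o t) = t by apply/funext => k /=; rewrite gf.
Qed.

Lemma isomorphic_trans M N O :
  isomorphic M N -> isomorphic N O -> isomorphic M O.
Proof.
move=> [f [bf hf]] [g [bg hg]]; exists (g \o f); split; first exact: bij_comp.
by move=> s t; rewrite hf hg.
Qed.

End Games.

(** * Finite structures *)

Lemma inj_surj_bijective (X Y : Type) (f : X -> Y) :
  injective f -> (forall y, exists x, f x = y) -> bijective f.
Proof.
move=> fi /choice[g gK]; exists g => // x.
by apply: fi; rewrite gK.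
Qed.

(** A finite structure is determined by its theory, in any language: were each
    of the finitely many bijections to [N] refuted by some symbol, these symbols
    would make up a finite sublanguage in which [M] and [N] are not isomorphic. *)
Lemma finite_models_isomorphic (L : signature) (M N : structure L) :
  finite_set [set: M] -> models N (Th M) -> isomorphic M N.
Proof.
move=> /finite_set_enum[n [e he]] /models_Th_EF hMN.
have {}he x : exists k, e k = x by apply: he.
have hu F : finite_set F -> exists u : 'I_n -> N, EF F 1 (tuple_rel e u).
  move=> /(hMN F (n + 1)%N)/EF_tuple-/(_ e)[u hu]; exists u.
  by apply: EF_sub hu => // x y; right.
have usurj F (u : 'I_n -> N) : EF F 1 (tuple_rel e u) -> forall b, exists k, u k = b.
  move=> [_ [_ h]] b; have [a [[hat _] _]] := h b; have [k ak] := he a.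
  exists k; apply/(hat (e k) (u k) a b) => //; first by left; exists k.
  by right.
have [u0 /usurj u0s] := hu _ (finite_set0 _).
(* [e] enumerates [M]; it suffices that one tuple [u] be an answer to [e] in all
   the finite sublanguages at once *)
suff [u hu'] : exists u : 'I_n -> N,
    forall F, finite_set F -> EF F 1 (tuple_rel e u).
  have [f hf] : exists f : M -> N, forall x, exists k, e k = x /\ u k = f x.
    suff /choice[f hf] x : exists y, exists k, e k = x /\ u k = y by exists f.
    by have [k <-] := he x; exists (u k), k.
  have hR x : tuple_rel e u x (f x) by have [k [<- <-]] := hf x; exists k.
  have heq := (EF_atomic (hu' _ (finite_set0 _))).1.
  exists f; split; first apply: inj_surj_bijective.
  - by move=> x y; apply: (heq _ _ _ _ (hR x) (hR y)).2.
  - move=> b; have [k <-] := usurj _ _ (hu' _ (finite_set0 _)) b.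
    by exists (e k); apply/(heq (e k) _ (e k)) => //; exists k.
  - by move=> s t; apply: ((EF_atomic (hu' _ (finite_set1 s))).2 s).
apply: contrapT => hno.
have /choice[F hF] (g : {ffun 'I_n -> 'I_n}) : exists F : set (symbol L),
    finite_set F /\ ~ EF F 1 (tuple_rel e (u0 \o g)).
  apply: contrapT => hg; apply: hno; exists (u0 \o g) => F fF.
  by apply: contrapT => hE; apply: hg; exists F.
have /hu[u hE] : finite_set (\bigcup_g F g).
  by apply: bigcup_finite => [|g _]; [exact: finite_finset|case: (hF g)].
have /choice[g hg] k : exists j, u0 j = u k by [].
have [_] := hF (finfun g); apply.
apply: EF_sub hE => [|x y [k [-> ->]]]; first exact: bigcup_sup.
by exists k; rewrite /= ffunE hg.
Qed.

Lemma models_finite (L : signature) (M N : structure L) :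
  models N (Th M) -> finite_set [set: N] -> finite_set [set: M].
Proof.
move=> /models_Th_sym hMN fN; have [f [[g fg gf] _]] := finite_models_isomorphic fN hMN.
apply: (@sub_finite_set _ _ (f @` setT)); last exact: finite_image.
by move=> x _; exists (g x).
Qed.

(** * Elementary substructures *)

Section Substructures.
Variables (L : signature) (M : structure L).

Definition substructure (Y : set M) : structure L :=
  @Structure L (set_type Y) (fun s t => rel (fun k => sval (t k))).

(** The Tarski-Vaught criterion for [substructure Y] to be elementary in [M]. *)
Definition tarski_vaught (Y : set M) :=
  forall n (phi : formula L n.+1) (e : 'I_n -> M), (forall k, Y (e k)) ->
    (exists a, sat phi (env_cons a e)) ->
    exists a, Y a /\ sat phi (env_cons a e).

Lemma substructure_sat (Y : set M) : tarski_vaught Y ->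
  forall n (phi : formula L n) (e : 'I_n -> substructure Y),
    sat phi e <-> sat phi (fun k => sval (e k)).
Proof.
move=> hY n phi; elim: phi => {n} [n|n x y|n s x|n phi IH psi IH'|n phi IH] e //=.
- by split=> [->|]//; exact: val_inj.
- by rewrite IH IH'.
- have hc (a : substructure Y) :
      (fun k => sval (env_cons a e k)) = env_cons (sval a) (fun k => sval (e k)).
    by apply/funext => k; rewrite /env_cons; case: unlift.
  split=> [h a|h a]; last by rewrite IH hc.
  apply: contrapT => ha.
  have [] := hY n (fnot phi) (fun k => sval (e k)).
  + by move=> k; apply: set_mem (valP _).
  + by exists a.
  + move=> b [Yb]; have := h (exist _ b (mem_set Yb)).
    by rewrite IH hc => hb hnb; apply: hnb.
Qed.

Lemma substructure_models (Y : set M) :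
  tarski_vaught Y -> models (substructure Y) (Th M).
Proof.
move=> hY phi hphi; rewrite /holds substructure_sat //.
by have -> : (fun k => sval (@env_nil (substructure Y) k)) = @env_nil M
  by apply/funext => -[].
Qed.

End Substructures.

(** * The downward Lowenheim-Skolem theorem *)

Section FormulaCode.
Variables (L : signature) (c : symbol L -> nat).

Fixpoint formula_code n (phi : formula L n) : GenTree.tree nat :=
  match phi with
  | FFalse => GenTree.Leaf 0
  | FEq x y => GenTree.Node 0 [:: GenTree.Leaf (x : nat); GenTree.Leaf (y : nat)]
  | FRel s x => GenTree.Node 1 (GenTree.Leaf (c s) ::
      [seq GenTree.Leaf (x k : nat) | k <- enum 'I_(arity s)])
  | FImp phi psi => GenTree.Node 2 [:: formula_code phi; formula_code psi]
  | FAll phi => GenTree.Node 3 [:: formula_code phi]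
  end.

Lemma formula_code_inj n : injective c -> injective (@formula_code n).
Proof.
move=> ci phi; elim: phi => {n} [n|n x y|n s x|n phi IH psi IH'|n phi IH].
- by case.
- by case=> //= x' y' [/val_inj -> /val_inj ->].
- case=> //= s' x' [/ci ss']; subst s' => /eq_in_map h.
  congr FRel; apply/funext => k; have := h k; rewrite mem_enum => /(_ isT)[].
  exact: val_inj.
- by case=> //= phi' psi' [/IH -> /IH' ->].
- by case=> //= phi' [/IH ->].
Qed.

End FormulaCode.

Lemma countable_formula (L : signature) n :
  countable [set: symbol L] -> countable [set: formula L n].
Proof.
move=> /countable_injP[c hc].
have ci : injective c by move=> s s'; apply: hc; rewrite inE.
apply/countable_injP; exists (fun phi => pickle (formula_code c phi)).
by move=> phi psi _ _ /(pcan_inj pickleK)/(formula_code_inj ci).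
Qed.

Lemma countable_tuples (T : Type) n (Y : set T) : countable Y ->
  countable [set e : 'I_n -> T | forall k, Y (e k)].
Proof.
move=> /countable_injP[c hc]; apply/countable_injP.
exists (fun e => pickle [ffun k => c (e k)]) => e e'.
rewrite !inE => he he' /(pcan_inj pickleK)/ffunP h; apply/funext => k.
by apply: hc; rewrite ?inE//; have := h k; rewrite !ffunE.
Qed.

(** [Y] is obtained from [X] by adding, countably often, a witness for each true
    existential statement about the points that are already there. *)
Theorem lowenheim_skolem (L : signature) (M : structure L) (X : set M) :
  countable [set: symbol L] -> countable X ->
  exists Y : set M, [/\ X `<=` Y, countable Y & tarski_vaught Y].
Proof.
move=> cL cX; have [[a0 _]|hM] := pselect (exists a : M, True); last first.
  exists X; split=> // n phi e _ [a _].
  by case: hM; exists a.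
have [W hW] : exists W : forall n, formula L n.+1 -> ('I_n -> M) -> M,
    forall n phi e, (exists a, sat phi (env_cons a e)) ->
      sat phi (env_cons (W n phi e) e).
  have /choice[W hW] (t : {n & (formula L n.+1 * ('I_n -> M))%type}) :
      exists b, (exists a, sat (tagged t).1 (env_cons a (tagged t).2)) ->
        sat (tagged t).1 (env_cons b (tagged t).2).
    have [[a ha]|h] := pselect (exists a, sat (tagged t).1 (env_cons a (tagged t).2)).
      by exists a.
    by exists a0.
  exists (fun n phi e => W (existT _ n (phi, e))) => n phi e h.
  exact: (hW (existT _ n (phi, e)) h).
pose step (Y : set M) := \bigcup_n \bigcup_phi
  [set W n phi e | e in [set e : 'I_n -> M | forall k, Y (e k)]].
pose Ys := fix Ys j := if j is j'.+1 then
  \bigcup_(b : bool) (if b then Ys j' else step (Ys j')) else X.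
have YsS j : Ys j `<=` Ys j.+1 by move=> x hx; exists true.
have Ysle i j : (i <= j)%N -> Ys i `<=` Ys j.
  by move=> /subnKC <-; elim: (j - i)%N => [|m IH]; rewrite ?addn0 ?addnS // => x /IH/YsS.
exists (\bigcup_j Ys j); split.
- by move=> x Xx; exists 0%N.
- apply: bigcup_countable => [|j _]; first exact: countableP.
  elim: j => [//|j IH]; apply: bigcup_countable => [|b _]; first exact: countableP.
  case: b => //; apply: bigcup_countable => [|n _]; first exact: countableP.
  apply: bigcup_countable => [|phi _]; first exact: countable_formula.
  exact/(sub_countable (card_image_le _ _))/countable_tuples.
- move=> n phi e he hphi.
  have /choice[J hJ] k : exists j, Ys j (e k) by have [j _ ?] := he k; exists j.
  exists (W n phi e); split; last exact: hW.
  exists (\max_k J k).+1 => //; exists false => //; exists n => //; exists phi => //.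
  by exists e => // k; apply: Ysle (hJ k); exact: leq_bigmax.
Qed.

Corollary countable_model_exists (L : signature) (M : structure L) :
  countable [set: symbol L] ->
  exists N : structure L, models N (Th M) /\ countable [set: N].
Proof.
move=> cL; have [Y [_ cY hY]] := lowenheim_skolem cL (countable0 M).
exists (substructure Y); split; first exact: substructure_models.
by rewrite /= (eq_countable (card_setT Y)).
Qed.

(** * Ultrapowers *)

Section Ultrapower.
Variables (L : signature) (M : structure L) (D : set_system nat).
Hypothesis hD : UltraFilter D.

(** Points of the ultrapower are classes of sequences that agree almost
    everywhere; its relations are evaluated on chosen representatives. *)
Definition ultra_class (f : nat -> M) : set (nat -> M) :=
  [set g | D [set j | f j = g j]].

Definition ultra_carrier := {C : set (nat -> M) | exists f, C = ultra_class f}.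

Definition ultra_elt (f : nat -> M) : ultra_carrier :=
  exist _ (ultra_class f) (ex_intro _ f erefl).

Definition ultra_repr (c : ultra_carrier) : nat -> M := sval (cid (svalP c)).

Definition ultrapower : structure L :=
  @Structure L ultra_carrier
    (fun s t => D [set j | rel (fun k => ultra_repr (t k) j)]).

Lemma ultra_repr_elt f : D [set j | ultra_repr (ultra_elt f) j = f j].
Proof.
have h : ultra_class f = ultra_class (ultra_repr (ultra_elt f)).
  by rewrite /ultra_repr; case: cid.
have /= : ultra_class f f by apply: filterS filterT.
by rewrite h.
Qed.

Lemma ultra_eq (c d : ultra_carrier) :
  D [set j | ultra_repr c j = ultra_repr d j] -> c = d.
Proof.
rewrite /ultra_repr; case: cid => f hf; case: cid => g hg /= hfg.
apply: eq_sig_hprop => // /=; rewrite hf hg; apply/seteqP; split=> x hx.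
  by apply: filterS2 hfg hx => j /= -> .
by apply: filterS2 hfg hx => j /= -> .
Qed.

Lemma ultraN (X : set nat) : ~ D X <-> D (~` X).
Proof.
split=> [h|h h']; first by case: (in_ultra_setVsetC X hD).
by have /filter_ex[j []] : D (X `&` ~` X) by apply: filterI.
Qed.

(** Los's theorem. If [FAll phi] fails in almost every factor, a sequence of
    counterexamples is a counterexample in the ultrapower. *)
Lemma ultrapower_sat n (phi : formula L n) (e : 'I_n -> ultrapower) :
  sat phi e <-> D [set j | sat phi (fun k => ultra_repr (e k) j)].
Proof.
elim: phi e => {n} [n|n x y|n s x|n phi IH psi IH'|n phi IH] e /=.
- by split=> // h; have [] := filter_ex h.
- split=> [->|/ultra_eq//]; by apply: filterS filterT.
- by [].
- rewrite IH IH'; split=> [h|h hphi]; last by apply: filterS2 h hphi => j; apply.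
  have [/h|/ultraN] := pselect (D [set j | sat phi (fun k => ultra_repr (e k) j)]).
    by apply: filterS => j ? ?.
  by apply: filterS => j /= hn /hn.
- have hc (c : ultrapower) j : (fun k => ultra_repr (env_cons c e k) j) =
      env_cons (ultra_repr c j) (fun k => ultra_repr (e k) j).
    by apply/funext => k; rewrite /env_cons; case: unlift.
  split=> [h|h c]; last first.
    by rewrite IH; apply: filterS h => j /(_ (ultra_repr c j)); rewrite -hc.
  apply: contrapT => /ultraN hn; have [j0 /= hj0] := filter_ex hn.
  have [f hf] : exists f : nat -> M, forall j,
      (exists a, ~ sat phi (env_cons a (fun k => ultra_repr (e k) j))) ->
      ~ sat phi (env_cons (f j) (fun k => ultra_repr (e k) j)).
    have [a0 _] : exists a : M, True.
      by apply: contrapT => hM; apply: hj0 => a; case: hM; exists a.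
    suff /choice[f hf] j : exists b,
      (exists a, ~ sat phi (env_cons a (fun k => ultra_repr (e k) j))) ->
      ~ sat phi (env_cons b (fun k => ultra_repr (e k) j)) by exists f.
    have [[a ha]|] := pselect (exists a,
      ~ sat phi (env_cons a (fun k => ultra_repr (e k) j))); first by exists a.
    by exists a0.
  have /IH hs := h (ultra_elt f).
  have [j [[/= h1 h2] h3]] := filter_ex (filterI (filterI hs (ultra_repr_elt f)) hn).
  by move: h1; rewrite hc h2; apply: hf; apply/existsNP.
Qed.

Lemma ultrapower_models : models ultrapower (Th M).
Proof.
move=> phi hphi; rewrite /holds ultrapower_sat.
apply: filterS filterT => j _; rewrite /=.
by have -> : (fun k => ultra_repr (@env_nil ultrapower k) j) = @env_nil M
  by apply/funext => -[].
Qed.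

End Ultrapower.

Lemma nonprincipal_ultrafilter : exists D : set_system nat,
  UltraFilter D /\ forall N, D [set j | (N <= j)%N].
Proof.
have [D [hD sub]] := ultraFilterLemma eventually_filter.
by exists D; split=> // N; apply: sub; exists N.
Qed.

(** * Connected components *)

Section Connectivity.
Variables (L : signature).
Implicit Types (M N : structure L) (F : set (symbol L)).

Definition adjacent M F (u v : M) := exists s (t : 'I_(arity s) -> M) k l,
  [/\ F s, rel t, t k = u & t l = v].

Definition adjacency_closed M (V : set M) :=
  forall s (t : 'I_(arity s) -> M) k l, rel t -> V (t k) -> V (t l).

(** Connectivity for the adjacency given by all the symbols, by way of the sets
    that are closed under it; no path has to be mentioned. *)
Definition connected M (u v : M) :=
  forall V : set M, adjacency_closed V -> V u -> V v.

Lemma connected_sym M (u v : M) : connected u v -> connected v u.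
Proof.
move=> h V hV Vv; apply: contrapT => hu; apply: (h (~` V)) => // s t k l ht hk Vl.
exact/hk/(hV s t l).
Qed.

Lemma connected_trans M (u v w : M) :
  connected u v -> connected v w -> connected u w.
Proof. by move=> h h' V hV /h-/(_ hV)/h'; apply. Qed.

Lemma adjacent_connected M F (u v : M) : adjacent F u v -> connected u v.
Proof. by move=> [s [t [k [l [_ ht <- <-]]]]] V hV; apply: hV. Qed.

Lemma adjacent_sym M F (u v : M) : adjacent F u v -> adjacent F v u.
Proof. by move=> [s [t [k [l [Fs ht tu tv]]]]]; exists s, t, l, k. Qed.

(** A path of length at most [d] whose steps use symbols of [F] only, so that the
    game restricted to [F] can follow it. *)
Fixpoint near M F d (u v : M) : Prop :=
  if d is d'.+1 then exists2 w, u = w \/ adjacent F u w & near F d' w v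
  else u = v.

Lemma near_refl M F d (u : M) : near F d u u.
Proof. by elim: d => //= d IH; exists u => //; left. Qed.

Lemma near_trans M F d d' (u v w : M) :
  near F d u v -> near F d' v w -> near F (d + d') u w.
Proof.
elim: d u => [|d IH] u /=; first by move=> ->.
by move=> [x ux xv] vw; exists x => //; exact: IH.
Qed.

Lemma near_sym M F d (u v : M) : near F d u v -> near F d v u.
Proof.
elim: d u => [//|d IH] u [x ux /IH xv]; rewrite -addn1.
apply: near_trans xv _; exists u => //.
by case: ux => [->|/adjacent_sym]; [left|right].
Qed.

Lemma near_leq M F d d' (u v : M) : (d <= d')%N -> near F d u v -> near F d' u v.
Proof. by move=> /subnK <- h; apply: near_trans h; exact: near_refl. Qed.

Lemma near_connected M F d (u v : M) : near F d u v -> connected u v.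
Proof.
elim: d u => [u /= ->|d IH u [w [->|/adjacent_connected h] /IH]] //.
exact: connected_trans.
Qed.

Lemma arity_bound F : finite_set F ->
  exists A, forall s, F s -> (arity s <= A)%N.
Proof.
move=> /finite_set_enum[n [f hf]]; exists (\max_(j < n) arity (f j)).
by move=> s /hf[j <-]; exact: (leq_bigmax j).
Qed.

(** Short paths are visible to the game, since the spoiler can play their
    points and the entries of the tuples that link them. *)
Lemma EF_near M N F A d (R : M -> N -> Prop) u u' v v' :
  (forall s, F s -> (arity s <= A)%N) ->
  EF F (d + A) R -> R u u' -> R v v' -> near F d u v -> near F d u' v'.
Proof.
move=> hA; elim: d R u u' => [|d IH] R u u' hE uu' vv' /=.
  by move=> uv; apply/((EF_atomic hE).1 u u' v v').
move=> [w uw wv]; move: hE; rewrite addSn => -[_ [/(_ w)[w' hE] _]].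
exists w'; last by apply: (IH _ w w' hE) => //; [right|left].
case: uw => [uw|[s [t [k [l [Fs ht tu tw]]]]]].
  by left; apply/((EF_atomic hE).1 u u' w w') => //; [left|right].
have hq : (arity s + 0 <= d + A)%N.
  by rewrite addn0; apply: leq_trans (hA s Fs) _; exact: leq_addl.
have [t' /EF_atomic[heq hrel]] := EF_tuple t (EF_leq hq hE).
right; exists s, t', k, l; split=> //.
- by apply/(hrel s Fs t t') => // j; right; exists j.
- apply/(heq (t k) (t' k) u u') => //; first by right; exists k.
  by left; left.
- apply/(heq (t l) (t' l) w w') => //; first by right; exists l.
  by left; right.
Qed.

(** The position in which the cluster of points [g] and the cluster of their
    counterparts [h], for [G g h], are swapped and the points in [Z] are fixed. *)
Definition swap M (G : M -> M -> Prop) (Z : set M) : M -> M -> Prop :=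
  fun u v => [\/ G u v, G v u | u = v /\ Z u].

Definition swap_far M F d (G : M -> M -> Prop) (Z : set M) :=
  (forall g h g' h', G g h -> G g' h' -> ~ near F d g h') /\
  (forall g h z, G g h -> Z z -> ~ near F d g z /\ ~ near F d h z).

Lemma swap_far_flip M F d (G : M -> M -> Prop) Z :
  swap_far F d G Z -> swap_far F d (flip_rel G) Z.
Proof.
move=> [h1 h2]; split=> [g h g' h' Ghg Ghg' /near_sym|g h z Ghg Zz].
  exact: (h1 _ _ _ _ Ghg' Ghg).
by have [] := h2 _ _ _ Ghg Zz.
Qed.

Lemma swap_sym M (G : M -> M -> Prop) Z u v : swap G Z u v -> swap G Z v u.
Proof. by case=> [h|h|[-> h]]; [apply: Or32|apply: Or31|apply: Or33]. Qed.

(** Each round costs one move of the strategy for the clusters, and this strategy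
    must preserve paths of length [3 ^ q'], which takes [3 ^ q' + A] moves. *)
Fixpoint swap_rank A q :=
  if q is q'.+1 then ((3 ^ q' + A) + swap_rank A q').+1 else 0.

Lemma swap_atomic M F (G : M -> M -> Prop) Z :
  atomic_agree F G -> swap_far F 1 G Z -> atomic_agree F (swap G Z).
Proof.
move=> [heq hrel] hfar; have [far1 far2] := hfar.
have e1 (u v : M) : u = v -> near F 1 u v by move=> ->; exact: near_refl.
have adj1 s (t : 'I_(arity s) -> M) k l : F s -> rel t -> near F 1 (t k) (t l).
  by move=> Fs ht; exists (t l) => //; right; exists s, t, k, l.
split=> [u v u' v'|s Fs].
  have half (x y x' y' : M) : swap G Z x y -> swap G Z x' y' -> x = x' -> y = y'.
    case=> [Gxy|Gyx|[<- Zx]] [Gxy'|Gyx'|[<- Zx']] // /[dup] xx' /e1 n1.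
    - by apply/(heq x y x' y').
    - by case: (far1 _ _ _ _ Gxy Gyx').
    - by case: (far2 _ _ _ Gxy Zx').1.
    - by case: (far1 _ _ _ _ Gxy' Gyx (near_sym n1)).
    - by apply/(heq y x y' x').
    - by case: (far2 _ _ _ Gyx Zx').2.
    - by case: (far2 _ _ _ Gxy' Zx).1; exact: near_sym.
    - by case: (far2 _ _ _ Gyx' Zx).2; exact: near_sym.
  move=> h h'; split; first exact: half.
  by apply: half; exact: swap_sym.
suff half (t u : 'I_(arity s) -> M) :
    (forall k, swap G Z (t k) (u k)) -> rel t -> rel u.
  by move=> t u htu; split; apply: half => // k; exact: swap_sym.
move=> htu ht; have [[k0 _]|hk] := pselect (exists k : 'I_(arity s), True); last first.
  by have <- : t = u by apply/funext => k; case: hk; exists k.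
case: (htu k0) => [G0|G0|[e0 Z0]].
- apply/(hrel s Fs t u) => // k; case: (htu k) => // [Gk|[_ Zk]].
    by case: (far1 _ _ _ _ G0 Gk); exact: adj1.
  by case: (far2 _ _ _ G0 Zk).1; exact: adj1.
- apply/(hrel s Fs u t) => // k; case: (htu k) => // [Gk|[_ Zk]].
    by case: (far1 _ _ _ _ Gk G0); exact: adj1.
  by case: (far2 _ _ _ G0 Zk).2; exact: adj1.
- have <- // : t = u; apply/funext => k; case: (htu k) => [Gk|Gk|[]//].
    by case: (far2 _ _ _ Gk Z0).1; exact: adj1.
  by case: (far2 _ _ _ Gk Z0).2; exact: adj1.
Qed.

(** A move near one of the two clusters is answered near the other one, by the
    strategy for [G]; any other move is copied. With [q] rounds to go the
    clusters and the fixed points must be at distance more than [3 ^ q]: a move at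
    distance [3 ^ q] from one cluster brings the two clusters closer by
    [2 * 3 ^ q] in all, as its answer is equally close to the other one. *)
Lemma EF_swap M F A q (G : M -> M -> Prop) Z :
  (forall s, F s -> (arity s <= A)%N) ->
  EF F (swap_rank A q) G -> swap_far F (3 ^ q) G Z -> EF F q (swap G Z).
Proof.
move=> hA; elim: q G Z => [|q IH] G Z hG hfar.
  by split=> //; exact: swap_atomic (EF_atomic hG) hfar.
have le3 : (3 ^ q + (3 ^ q + 3 ^ q) <= 3 ^ q.+1)%N by rewrite expnS !mulSn mul0n addn0.
have le2 : (3 ^ q + 3 ^ q <= 3 ^ q.+1)%N by apply: leq_trans le3; exact: leq_addl.
have le1 : (3 ^ q <= 3 ^ q.+1)%N by apply: leq_trans le2; exact: leq_addl.
have farS d d' (G' : M -> M -> Prop) Z' :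
  (d <= d')%N -> swap_far F d' G' Z' -> swap_far F d G' Z'.
  move=> dd' [h1 h2]; split=> [g h g' h' ? ? ?|g h z Ggh Zz].
    by apply: (h1 g h g' h') => //; exact: near_leq dd' _.
  by have [n1 n2] := h2 g h z Ggh Zz; split=> n; [apply: n1|apply: n2];
    exact: near_leq dd' n.
have clusterP G' : EF F (swap_rank A q.+1) G' -> swap_far F (3 ^ q.+1) G' Z ->
    forall a g h, G' g h -> near F (3 ^ q) g a ->
    exists b, EF F q (extend (swap G' Z) a b).
  move=> [_ [hE _]] [far1 far2] a g h Ggh ga; have [b hb] := hE a.
  have hnear : near F (3 ^ q) h b.
    apply: (EF_near hA (EF_leq _ hb) _ _ ga); [exact: leq_addr|by left|by right].
  exists b; apply: EF_sub (IH (extend G' a b) Z _ _) => //.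
  - move=> x y [[h1|h1|h1]|h1]; [by apply: Or31; left|by apply: Or32; left|exact: Or33|].
    by apply: Or31; right.
  - by apply: EF_leq hb; exact: leq_addl.
  - split=> [x y x' y' [h1|[-> _]] [h2|[_ ->]] n|x y z [h1|[-> ->]] Zz].
    + exact: (far1 _ _ _ _ h1 h2 (near_leq le1 n)).
    + exact: (far1 _ _ _ _ h1 Ggh (near_leq le2 (near_trans n (near_sym hnear)))).
    + exact: (far1 _ _ _ _ Ggh h2 (near_leq le2 (near_trans ga n))).
    + apply: (far1 _ _ _ _ Ggh Ggh); apply: near_leq le3 _.
      exact: near_trans ga (near_trans n (near_sym hnear)).
    + by have [n1 n2] := far2 _ _ _ h1 Zz; split=> n; [apply: n1|apply: n2];
        exact: near_leq le1 n.
    + have [n1 n2] := far2 _ _ _ Ggh Zz; split=> n; [apply: n1|apply: n2].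
        exact: near_leq le2 (near_trans ga n).
      exact: near_leq le2 (near_trans hnear n).
have forth a : exists b, EF F q (extend (swap G Z) a b).
  have [[g [h [Ggh ga]]]|no1] := pselect (exists g h, G g h /\ near F (3 ^ q) g a).
    exact: clusterP hG hfar a g h Ggh ga.
  have [[g [h [Ggh ga]]]|no2] := pselect (exists g h, G g h /\ near F (3 ^ q) h a).
    have [b hb] := clusterP _ (EF_flip hG) (swap_far_flip hfar) a h g Ggh ga.
    exists b; apply: EF_sub hb => // x y [[h1|h1|h1]|]; last by right.
    + by left; apply: Or32.
    + by left; apply: Or31.
    + by left; apply: Or33.
  exists a; apply: EF_sub (IH G (Z `|` [set a]) _ _) => //.
  - move=> x y [[h1|h1|[-> h1]]|[-> ->]]; [exact: Or31|exact: Or32| |].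
      by apply: Or33; split=> //; left.
    by apply: Or33; split=> //; right.
  - apply: EF_leq hG; rewrite /= -addnS addnC.
    exact: leq_trans (leqnSn _) (leq_addr _ _).
  - have [h1 h2] := farS _ _ _ _ le1 hfar; split=> // g h z Ggh [Zz|->].
      exact: h2 Ggh Zz.
    by split=> n; [apply: no1|apply: no2]; exists g, h.
split; last split=> [//|b].
  by apply: swap_atomic (EF_atomic hG) (farS _ _ _ _ _ hfar); rewrite expn_gt0.
have [a ha] := forth b; exists a.
apply: EF_sub (EF_flip ha) => // x y [/swap_sym h|[-> ->]]; [by left|by right].
Qed.

(** Two points of equal type, for long enough games, connected neither to each
    other nor to the parameters, have the same type over the parameters: start
    [EF_swap] from two clusters of one point each. *)
Lemma EF_exchange F q : finite_set F -> exists Q,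
  forall M n (e : 'I_n -> M) (a a' : M),
    EF F Q (fun x y => x = a /\ y = a') -> ~ connected a a' ->
    (forall k, ~ connected a (e k) /\ ~ connected a' (e k)) ->
    EF F q (tuple_rel (env_cons a e) (env_cons a' e)).
Proof.
move=> /arity_bound[A hA]; exists (swap_rank A q) => M n e a a' hE haa' hae.
apply: EF_sub (EF_swap (Z := range e) hA hE _) => //.
  move=> x y /tuple_rel_cons[[k [-> ->]]|[-> ->]]; last exact: Or31.
  by apply: Or33; split=> //; exists k.
split=> [g h g' h' [-> _] [_ ->] /near_connected//|g h _ [-> ->] [k _ <-]].
by split=> /near_connected h'; have [] := hae k.
Qed.

End Connectivity.

(** * Counting countable models *)

Section Counting.
Variables (L : signature) (T : theory L).
Implicit Types M N : structure L.

Definition countable_model N :=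
  [/\ models N T, countable [set: N] & infinite_set [set: N]].

Lemma countable_modelP N :
  countable_model N <-> models N T /\ [set: N] #= [set: nat].
Proof.
split=> [[hN cN iN]|[hN e]].
  by split=> //; rewrite card_eq_le; apply/andP; split=> //; apply/infiniteP.
split=> //; first by rewrite (eq_countable e); exact: countableP.
by rewrite (eq_finite_set e); exact: infinite_nat.
Qed.

(** Finiteness of the number of countable models, expressed by an invariant with
    finitely many values that separates the isomorphism classes. *)
Definition finitely_many_models := exists (K : finType) (c : structure L -> K),
  forall M N, countable_model M -> countable_model N -> c M = c N ->
    isomorphic M N.

Lemma number_finitely_many n :
  number_of_models T nat 'I_n -> finitely_many_models.
Proof.
move=> [M [hM _ hN]].
have /choice[c hc] N : exists o : option 'I_n,
    countable_model N -> exists2 k, o = Some k & isomorphic N (M k).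
  have [|hn] := pselect (countable_model N); last by exists None.
  move=> /countable_modelP[h1 h2]; have [k hk] := hN N h1 h2.
  by exists (Some k) => _; exists k.
exists (option 'I_n), c => N N' /hc[k -> Nk] /hc[k' -> Nk'] [kk'].
by apply: isomorphic_trans Nk _; rewrite kk'; exact: isomorphic_sym.
Qed.

(** Isomorphic structures may have different values of [c]; the set [c' N] of the
    values on the isomorphism class of [N] is a complete invariant. *)
Lemma finitely_many_number :
  finitely_many_models -> exists n, number_of_models T nat 'I_n.
Proof.
move=> [K [c hc]].
pose c' N := [set j | `[< exists N',
  [/\ isomorphic N' N, countable_model N' & c N' = j] >]]%SET.
pose J := [set X | `[< exists2 N, countable_model N & c' N = X >]]%SET.
have hJ (k : 'I_#|J|) : exists N, countable_model N /\ c' N = enum_val k.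
  by have := enum_valP k; rewrite inE => /asboolP[N ? ?]; exists N.
have [M hM] := choice hJ.
have c'iso N N' : isomorphic N N' -> c' N = c' N'.
  move=> h; apply/setP => j; rewrite !inE; apply/asboolP/asboolP => -[O [ho cO cj]].
    by exists O; split=> //; exact: isomorphic_trans ho h.
  by exists O; split=> //; exact: isomorphic_trans ho (isomorphic_sym h).
exists #|J|, M; split=> [k|k l /c'iso|N hN eN].
- by have [/countable_modelP] := hM k.
- by case: (hM k) (hM l) => [_ ->] [_ ->] /enum_val_inj.
- have cN : countable_model N by apply/countable_modelP.
  have hc'N : c' N \in J by rewrite inE; apply/asboolP; exists N.
  exists (enum_rank_in hc'N (c' N)); set k := enum_rank_in _ _.
  have [cM] := hM k; rewrite enum_rankK_in // => /setP/(_ (c N)).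
  rewrite !inE; set a := asbool _; set b := asbool _ => ab.
  have : b by apply/asboolP; exists N; split=> //; exact: isomorphic_refl.
  rewrite -ab => /asboolP[N' [N'M cN' e]].
  exact: isomorphic_trans (hc _ _ cN cN' (esym e)) N'M.
Qed.

Lemma Ehrenfeucht_theoryP : Ehrenfeucht_theory T <->
  finitely_many_models /\
  exists M N, [/\ countable_model M, countable_model N & ~ isomorphic M N].
Proof.
split=> [[n [n1 hn]]|[/finitely_many_number[n hn] [N [N' [cN cN' hNN']]]]].
  split; first exact: number_finitely_many hn.
  case: hn => M [hM Minj _].
  exists (M (Ordinal (ltnW n1))), (M (Ordinal n1)).
  by split; [apply/countable_modelP|apply/countable_modelP|move=> /Minj/(congr1 val)].
exists n; split=> //; case: hn => M [_ _ hM].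
move: cN cN' => /countable_modelP[h1 h2] /countable_modelP[h3 h4].
have [[k Nk] [l Nl]] := (hM _ h1 h2, hM _ h3 h4).
rewrite ltnNge; apply/negP => n1; apply: hNN'.
suff kl : k = l by apply: isomorphic_trans Nk _; rewrite kl; exact: isomorphic_sym.
apply: val_inj; move: (leq_trans (ltn_ord k) n1) (leq_trans (ltn_ord l) n1).
by rewrite !ltnS !leqn0 => /eqP/= -> /eqP/= ->.
Qed.

Lemma omega_categorical_theoryP : omega_categorical_theory T <->
  (exists M, countable_model M) /\
  forall M N, countable_model M -> countable_model N -> isomorphic M N.
Proof.
split=> [[M [hM _ hN]]|[[M cM] hiso]].
  split=> [|N N']; first by exists (M ord0); apply/countable_modelP.
  move=> /countable_modelP[h1 h2] /countable_modelP[h3 h4].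
  have [[k Nk] [l Nl]] := (hN _ h1 h2, hN _ h3 h4).
  by apply: isomorphic_trans Nk (isomorphic_sym _); rewrite (ord1 k) -(ord1 l).
exists (fun=> M); split=> [k|k l _|N h1 h2]; first by apply/countable_modelP.
  by rewrite (ord1 k) (ord1 l).
by exists ord0; apply: hiso => //; apply/countable_modelP.
Qed.

Lemma many_models_not_finite (N : nat -> structure L) :
  (forall k, countable_model (N k)) ->
  (forall k l, isomorphic (N k) (N l) -> k = l) -> ~ finitely_many_models.
Proof.
move=> hN Ninj [K [c hc]].
have : injective (fun k : 'I_#|K|.+1 => c (N k)).
  by move=> k l /(hc _ _ (hN k) (hN l))/Ninj/val_inj.
by move=> /leq_card; rewrite card_ord ltnn.
Qed.

End Counting.

Lemma finitely_many_Th (L : signature) (M : structure L) :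
  countable [set: symbol L] -> infinite_set [set: M] ->
  finitely_many_models (Th M) -> omega_categorical M \/ Ehrenfeucht M.
Proof.
move=> cL iM fM.
have [|h] := pselect (exists N N', [/\ countable_model (Th M) N,
    countable_model (Th M) N' & ~ isomorphic N N']).
  by right; apply/Ehrenfeucht_theoryP.
left; split=> //; apply/omega_categorical_theoryP; split.
  have [N [hN cN]] := countable_model_exists M cL.
  by exists N; split=> // /(models_finite hN).
by move=> N N' cN cN'; apply: contrapT => hiso; apply: h; exists N, N'.
Qed.

Lemma omega_categorical_or_Ehrenfeucht_finitely_many (L : signature)
    (M : structure L) :
  omega_categorical M \/ Ehrenfeucht M -> finitely_many_models (Th M).
Proof.
by move=> [[_ /number_finitely_many]|[n [_ /number_finitely_many]]].
Qed.

Lemma card_leT_injective (X Y : Type) :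
  [set: X] #<= [set: Y] -> exists f : X -> Y, injective f.
Proof.
move=> /card_leP[f]; pose g (x : X) : [set: X] := exist _ x (in_setT x).
exists (fun x => sval (f (g x))) => x y /val_inj/(@inj _ _ _ f).
by rewrite !inE => /(_ Logic.I Logic.I)/(congr1 sval).
Qed.

(** * The structure of a combination *)

Section Combination.
Variables (S : signature) (U I : Type) (P : I -> symbol S).
Variable (A : I -> setstructure S U).
Hypothesis hP : universe_predicates P A.
Hypothesis hcomb : is_P_combination P A.
Hypothesis hdisj : trivIset [set: I] (fun i => univ (A i)).

Let AP := P_union P A.
Let LP := sublanguage (lang AP).
Let LA i := sublanguage (lang (A i)).
Implicit Types (M N : structure LP).

Lemma lang_predicate i : lang AP (P i).
Proof. by right; exists i. Qed.

Definition predicate i : symbol LP := exist _ (P i) (mem_set (lang_predicate i)).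

Lemma lang_member i s : lang (A i) s -> lang AP s.
Proof. by left; exists i. Qed.

Definition member_symbol i (s : symbol (LA i)) : symbol LP :=
  exist _ (sval s) (mem_set (lang_member (set_mem (valP s)))).

(** The arity of [P i] equals [1] only propositionally, so the predicate is
    evaluated on constant tuples; see [predicate_const]. *)
Definition part M i : set M := [set x | rel (s := predicate i) (fun _ => x)].
Arguments part : clear implicits.

Lemma predicate_ord i : 'I_(arity (P i)).
Proof. by have [_ -> _ _] := hP; exact: ord0. Qed.

Lemma predicate_const (X : Type) i (t : 'I_(arity (P i)) -> X) :
  t = fun _ => t (predicate_ord i).
Proof.
apply/funext => k; congr t; apply: val_inj => /=.
have [_ ar1 _ _] := hP.
have lt0 (j : 'I_(arity (P i))) : (j : nat) = 0%N.
  by case: j => m /=; rewrite ar1; case: m.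
by rewrite !lt0.
Qed.

Lemma part_combination i (x : AP) : part AP i x <-> univ (A i) (sval x).
Proof.
have [Pinj _ Pnew _] := hP; rewrite /part /=; split=> [|h]; last by right; exists i.
case=> [[j /interp_lang/Pnew//]|[j [/Pinj <-]]].
by apply; exact: predicate_ord.
Qed.

(** The only use of [is_P_combination]. As the universes are disjoint, what it
    adds to the union concerns nullary symbols: one in the language of [A i] holds
    in [A i] as soon as it holds in some [A j]. *)
Lemma interp_combination i s (t : 'I_(arity s) -> U) :
  interp (A i) t <-> [/\ interp AP t, forall k, univ (A i) (t k) & lang (A i) s].
Proof.
have -> : interp (A i) t =
  interp (reduct (restriction AP (univ (A i))) (lang (A i))) t.
  by rewrite /AP -hcomb.
by split=> [[[]]|[]].
Qed.

Lemma combination_disjoint i j (x : AP) : part AP i x -> part AP j x -> i = j.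
Proof.
move=> /part_combination hi /part_combination hj.
by apply: hdisj => //; exists (sval x).
Qed.

Lemma combination_cover (x : AP) : exists i, part AP i x.
Proof.
by have [i _ hi] := set_mem (valP x); exists i; apply/part_combination.
Qed.

Lemma combination_nonempty i : exists x, part AP i x.
Proof.
have [_ _ _ /(_ i)[u hu]] := hP.
have hu' : univ AP u by exists i.
by exists (exist _ u (mem_set hu')); apply/part_combination.
Qed.

Lemma combination_rel (s : symbol LP) (t : 'I_(arity s) -> AP) : rel t ->
  exists i, (s = predicate i \/ lang (A i) (sval s)) /\ forall k, part AP i (t k).
Proof.
case=> [[i hi]|[i [si hi]]]; exists i; split.
- by right; exact: interp_lang hi.
- by move=> k; apply/part_combination; exact: interp_univ hi k.
- by left; apply: val_inj.
- by move=> k; apply/part_combination; exact: hi.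
Qed.

(** * Models of the theory of a combination *)

Lemma EF_part M N F q (R : M -> N -> Prop) i x y :
  EF F q R -> F (predicate i) -> R x y -> part M i x <-> part N i y.
Proof. by move=> /EF_atomic[_ hr] /hr h Rxy; apply: h. Qed.

Lemma models_tuple (L : signature) (M N : structure L) F q n (t : 'I_n -> N) :
  models N (Th M) -> finite_set F ->
  exists u : 'I_n -> M, EF F q (tuple_rel t u).
Proof.
move=> /models_Th_sym/models_Th_EF h fF.
have [u hu] := EF_tuple t (h F (n + q)%N fF).
by exists u; apply: EF_sub hu => // x y; right.
Qed.

Section Model.
Variable M : structure LP.
Hypothesis hM : models M (Th AP).

Lemma model_disjoint i j (x : M) : part M i x -> part M j x -> i = j.
Proof.
have [u hu] := models_tuple 0 (fun _ : 'I_1 => x) hM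
  (finite_set2 (predicate i) (predicate j)).
have Rx : tuple_rel (fun _ : 'I_1 => x) u x (u ord0) by exists ord0.
rewrite (EF_part hu _ Rx); last by left.
rewrite (EF_part hu _ Rx); last by right.
exact: combination_disjoint.
Qed.

Lemma model_nonempty i : exists x, part M i x.
Proof.
have [x hx] := combination_nonempty i.
have [u hu] := models_tuple 0 (fun _ : 'I_1 => x) (models_Th_sym hM)
  (finite_set1 (predicate i)).
have Rx : tuple_rel (fun _ : 'I_1 => x) u x (u ord0) by exists ord0.
by exists (u ord0); apply/(EF_part hu _ Rx).
Qed.

Lemma model_part_closed i : adjacency_closed (part M i).
Proof.
move=> s t k l ht.
have [u hu] := models_tuple 0 t hM (finite_set2 s (predicate i)).
have Rt j : tuple_rel t u (t j) (u j) by exists j.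
rewrite !(EF_part hu _ (Rt _)); try by right.
have /combination_rel[j [_ hj]] : rel u.
  by apply/((EF_atomic hu).2 s _ t u) => //; left.
by move=> /(combination_disjoint (hj k)) <-.
Qed.

Lemma model_cover : finite_set [set: I] -> forall x, exists i, part M i x.
Proof.
move=> fI x.
have [u hu] := models_tuple 0 (fun _ : 'I_1 => x) hM (finite_image predicate fI).
have [i hi] := combination_cover (u ord0); exists i.
have Rx : tuple_rel (fun _ : 'I_1 => x) u x (u ord0) by exists ord0.
by apply/(EF_part hu _ Rx); [exists i|].
Qed.

Lemma model_rel (s : symbol LP) (t : 'I_(arity s) -> M) :
  finite_set [set: I] -> rel t ->
  exists i, (s = predicate i \/ lang (A i) (sval s)) /\ forall k, part M i (t k).
Proof.
move=> fI ht.
have fF : finite_set (range predicate `|` [set s]).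
  by rewrite finite_setU; split; [exact: finite_image|exact: finite_set1].
have [u hu] := models_tuple 0 t hM fF.
have Rt j : tuple_rel t u (t j) (u j) by exists j.
have /combination_rel[i [hi hj]] : rel u.
  by apply/((EF_atomic hu).2 s _ t u) => //; right.
exists i; split=> // k.
by apply/(EF_part hu _ (Rt k)) => //; left; exists i.
Qed.

End Model.

(** * Infinitely many predicates *)

Lemma connected_morphism (L : signature) (M N : structure L) (f : M -> N) u v :
  (forall s (t : 'I_(arity s) -> M), rel t -> rel (f \o t)) ->
  connected u v -> connected (f u) (f v).
Proof.
move=> hf h V hV; apply: (h (f @^-1` V)) => s t k l /hf ht.
exact: (hV s (f \o t)).
Qed.

Lemma connected_substructure (L : signature) (M : structure L) (Y : set M)
    (u v : substructure Y) :
  adjacency_closed Y -> connected (sval u) (sval v) -> connected u v.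
Proof.
move=> hY h V hV Vu.
have [|x Vx /val_inj <- //] := h (sval @` V) _ (ex_intro2 _ _ u Vu erefl).
move=> s t k l ht [x Vx xt].
have Yt j : Y (t j) by apply: (hY s t k j ht); rewrite -xt; exact: set_mem (valP x).
exists (exist _ (t l) (mem_set (Yt l))) => //.
apply: (hV s (fun j => exist _ (t j) (mem_set (Yt j))) k l ht).
by have <- : x = exist _ (t k) (mem_set (Yt k)) by apply: val_inj.
Qed.

(** A union of components that contains all the parts is an elementary
    substructure: a point outside the parts may be replaced with a point of the
    same type, up to a finite game, in a part that is free of parameters. *)
Lemma tarski_vaught_parts M (Y : set M) : models M (Th AP) ->
  (forall i, part M i `<=` Y) -> adjacency_closed Y -> tarski_vaught Y.
Proof.
move=> hM hparts hY n phi e he [a ha].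
have [Ya|Ya] := pselect (Y a); first by exists a.
have [F [q [fF hF]]] := EF_sat phi; have [Q hQ] := EF_exchange q fF.
(* [u ord0] is a copy of [a] in the combination; the symbols in [G] keep it out
   of the parts that contain parameters *)
pose G := \bigcup_k [set predicate i | i in [set i | part M i (e k)]].
have fG : finite_set G.
  apply: bigcup_finite => [|k _]; first exact: finite_finset.
  have [[i hi]|h] := pselect (exists i, part M i (e k)).
    apply: (@sub_finite_set _ _ [set predicate i]); last exact: finite_set1.
    by move=> s [j /= hj <-]; rewrite (model_disjoint hM hj hi).
  rewrite (_ : image _ _ = set0); first exact: finite_set0.
  by apply/seteqP; split=> // s [i hi _]; case: h; exists i.
have fFG : finite_set (F `|` G) by rewrite finite_setU.
have [u hu] := models_tuple Q (fun _ : 'I_1 => a) hM fFG.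
have Ra : tuple_rel (fun _ : 'I_1 => a) u a (u ord0) by exists ord0.
have [i hi] := combination_cover (u ord0).
have fFi : finite_set (F `|` [set predicate i]).
  by rewrite finite_setU; split=> //; exact: finite_set1.
(* [v ord0] is a copy of [u ord0] in [M], in the same part [i] *)
have [v hv] := models_tuple Q u (models_Th_sym hM) fFi.
have Rv : tuple_rel u v (u ord0) (v ord0) by exists ord0.
have hvi : part M i (v ord0).
  by apply/(EF_part hv _ Rv) => //; right.
have hei k : ~ part M i (e k).
  move=> hk; apply: Ya; apply: (hparts i).
  by apply/(EF_part hu _ Ra) => //; right; exists k => //; exists i.
exists (v ord0); split; first exact: hparts hvi.
apply/(hF _ _ (env_cons a e) (env_cons (v ord0) e)); last exact: ha.
apply: hQ.
- apply: EF_sub (EF_trans (EF_sub _ (fun x y h => h) hu) (EF_sub _ (fun x y h => h) hv)).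
  + exact: subset_refl.
  + by move=> x y [-> ->]; exists (u ord0).
  + exact: subsetUl.
  + exact: subsetUl.
- move=> /connected_sym h; apply: Ya; apply: (hparts i).
  exact: h (model_part_closed hM (i := i)) hvi.
- move=> k; split=> h; first by apply: Ya; exact: (connected_sym h hY (he k)).
  exact: hei (h _ (model_part_closed hM (i := i)) hvi).
Qed.

(** In an ultrapower, sequences that run through distinct parts define points
    outside all the parts, and sequences running through disjoint sets of parts
    define points in different components. *)
Lemma disconnected_points : [set: nat] #<= [set: I] ->
  exists (M : structure LP) (c : nat -> M),
    [/\ models M (Th AP), forall i l, ~ part M i (c l)
      & forall l l', connected (c l) (c l') -> l = l'].
Proof.
move=> /card_leT_injective[f f_inj].
(* the sequence defining [c l] runs through the parts [e l j], for all [j] *)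
pose e (l j : nat) := f (pickle (l, j)).
have e_inj l j l' j' : e l j = e l' j' -> (l, j) = (l', j').
  by move=> /f_inj/(pcan_inj pickleK).
have [a ha] := choice combination_nonempty.
have [D [hD Dgeq]] := nonprincipal_ultrafilter.
pose c l : ultrapower AP D := ultra_elt D (fun j => a (e l j)).
exists (ultrapower AP D), c; split; first exact: ultrapower_models.
- move=> i l hi.
  have hil : D [set j | e l j = i].
    apply: filterS2 hi (ultra_repr_elt _ (fun j => a (e l j))) => j /= hj hc.
    apply: combination_disjoint (ha _) _; rewrite -hc; exact: hj.
  have [j1 /= e1] := filter_ex hil.
  have [j2 [/= e2 lt]] := filter_ex (filterI hil (Dgeq j1.+1)).
  by have [jj] := e_inj l j1 l j2 (etrans e1 (esym e2)); rewrite jj ltnn in lt.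
- move=> l l' hc.
  pose V : set (ultrapower AP D) :=
    [set x | D [set j | exists j', part AP (e l j') (ultra_repr x j)]].
  have Vl : V (c l).
    apply: filterS (ultra_repr_elt _ (fun j => a (e l j))) => j /= ->.
    by exists j; exact: ha.
  have hV : adjacency_closed V.
    move=> s t k m ht; apply: filterS2 ht => j /= ht [j' hj']; exists j'.
    exact: (model_part_closed (fun _ h => h)) ht hj'.
  have Vl' := hc V hV Vl.
  have [j [/= [j' hj'] h]] :=
    filter_ex (filterI Vl' (ultra_repr_elt _ (fun j => a (e l' j)))).
  by rewrite h in hj'; have [] := e_inj _ _ _ _ (combination_disjoint hj' (ha _)).
Qed.

Lemma countable_disconnected_points :
  countable [set: symbol LP] -> [set: nat] #<= [set: I] ->
  exists (M : structure LP) (c : nat -> M),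
    [/\ models M (Th AP), countable [set: M], forall i l, ~ part M i (c l)
      & forall l l', connected (c l) (c l') -> l = l'].
Proof.
move=> cL /disconnected_points[M [c [hM hpart hconn]]].
have cc : countable (range c).
  exact/(sub_countable (card_image_le _ _))/countableP.
have [Y [hc cY hY]] := lowenheim_skolem cL cc.
have Yc l : Y (c l) by apply: hc; exists l.
exists (substructure Y), (fun l => exist _ (c l) (mem_set (Yc l))); split.
- exact: models_Th_trans hM (substructure_models hY).
- by rewrite /= (eq_countable (card_setT Y)).
- by move=> i l; exact: hpart.
- move=> l l' /(@connected_morphism LP (substructure Y) M (fun x => sval x)).
  by move=> /(_ (fun s t ht => ht))/hconn.
Qed.

(** * Infinitely many countable models *)

(** [Y k] has exactly [k] components outside the parts, and an isomorphism
    preserves both the parts and the components. *)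
Lemma isomorphic_component_count (M : structure LP) (c : nat -> M)
    (Y : nat -> set M) k l :
  (forall i m, ~ part M i (c m)) ->
  (forall m m', connected (c m) (c m') -> m = m') ->
  (forall j x, Y j x <->
    (exists i, part M i x) \/ exists2 m, (m < j)%N & connected x (c m)) ->
  (forall j, adjacency_closed (Y j)) ->
  isomorphic (substructure (Y k)) (substructure (Y l)) -> (k <= l)%N.
Proof.
move=> hpart hconn hY Ycl [f [[g fg gf] hf]].
have hg s t : @rel LP (substructure (Y l)) s t -> rel (g \o t).
  by rewrite hf; have -> : f \o (g \o t) = t by apply/funext => j /=; rewrite gf.
have Yc (m : 'I_k) : Y k (c m) by apply/hY; right; exists m.
pose d (m : 'I_k) : substructure (Y k) := exist _ (c m) (mem_set (Yc m)).
have /choice[h hh] (m : 'I_k) : exists m' : 'I_l, connected (sval (f (d m))) (c m').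
  have [[i hi]|[m' lt hm]] := (hY l (sval (f (d m)))).1 (set_mem (valP _)).
    case: (hpart i m); apply/(hf (predicate i) (fun=> d m)).
    exact: hi.
  by exists (Ordinal lt).
have : injective h.
  move=> m m' hmm; apply: val_inj; apply: hconn.
  have hfm : connected (sval (f (d m))) (sval (f (d m'))).
    apply: connected_trans (hh m) _; rewrite hmm; exact: connected_sym.
  have /(connected_morphism hg) := connected_substructure (Ycl l) hfm.
  rewrite !fg.
  exact: (@connected_morphism LP (substructure (Y k)) M (fun x => sval x)).
by move=> /leq_card; rewrite !card_ord.
Qed.

Lemma infinitely_many_models :
  infinite_set (univ AP) -> countable [set: symbol LP] -> [set: nat] #<= [set: I] ->
  exists N : nat -> structure LP, (forall k, countable_model (Th AP) (N k)) /\
    forall k l, isomorphic (N k) (N l) -> k = l.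
Proof.
move=> hinf cL /(countable_disconnected_points cL)[M [c [hM cM hpart hconn]]].
pose Y k : set M := [set x | (exists i, part M i x) \/
  exists2 m, (m < k)%N & connected x (c m)].
have Ycl k : adjacency_closed (Y k).
  move=> s t j l ht; case=> [[i hi]|[m lt hm]].
    by left; exists i; exact: (model_part_closed hM) ht hi.
  right; exists m => //; apply: connected_trans hm.
  by move=> V hV; exact: hV ht.
have mY k : models (substructure (Y k)) (Th AP).
  suff hY : tarski_vaught (Y k).
    exact: models_Th_trans hM (substructure_models hY).
  by apply: tarski_vaught_parts => // i x hx; left; exists i.
exists (fun k => substructure (Y k)); split=> [k|k l hkl]; first split.
- exact: mY.
- rewrite /= (eq_countable (card_setT (Y k))).
  by apply: sub_countable cM; apply: subset_card_le.
- move=> /(models_finite (mY k)) fAP; apply: hinf.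
  by rewrite -(eq_finite_set (card_setT (univ AP))).
- apply/eqP; rewrite eqn_leq; apply/andP; split.
    exact: isomorphic_component_count hpart hconn (fun j x => iff_refl _) Ycl hkl.
  exact: isomorphic_component_count hpart hconn (fun j x => iff_refl _) Ycl
    (isomorphic_sym hkl).
Qed.

(** * Finitely many predicates *)

Definition component M i : structure (LA i) :=
  @Structure (LA i) (set_type (part M i))
    (fun s t => @rel LP M (member_symbol s) (fun k => sval (t k))).

(** The predicate [predicate i] forces the duplicator to answer a move in the
    part [i] with a move in the part [i]. *)
Lemma EF_component M N i (F : set (symbol (LA i))) q (R : M -> N -> Prop) :
  EF ([set predicate i] `|` (member_symbol (i := i) @` F)) q R ->
  EF F q (fun (x : component M i) (y : component N i) => R (sval x) (sval y)).
Proof.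
set F' := _ `|` _.
have hat (R' : M -> N -> Prop) : atomic_agree F' R' -> atomic_agree F
    (fun (x : component M i) (y : component N i) => R' (sval x) (sval y)).
  move=> [heq hrel]; split=> [a b a' b' h h'|s Fs t u h].
    by split=> [e|e]; apply: val_inj; apply/(heq _ _ _ _ h h'); rewrite e.
  by apply: (hrel (member_symbol s)) => //; right; exists s.
have Fi : F' (predicate i) by left.
elim: q R => [|q IH] R [hR hq]; split; try exact: hat.
  by [].
case: hq => h1 h2; split=> [a|b].
- have [b hb] := h1 (sval a).
  have pb : part N i b.
    by apply/(EF_part hb Fi (x := sval a)); [right|exact: set_mem (valP a)].
  exists (exist _ b (mem_set pb)); apply: EF_sub (IH _ hb) => // x y.
  by case=> [h|[-> ->]]; [left|right].
- have [a ha] := h2 (sval b).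
  have pa : part M i a.
    by apply/(EF_part ha Fi (y := sval b)); [right|exact: set_mem (valP b)].
  exists (exist _ a (mem_set pa)); apply: EF_sub (IH _ ha) => // x y.
  by case=> [h|[-> ->]]; [left|right].
Qed.

Lemma component_models M N i :
  models N (Th M) -> models (component N i) (Th (component M i)).
Proof.
move=> /models_Th_EF h; apply/models_Th_EF => F q fF.
have fF' : finite_set ([set predicate i] `|` (member_symbol (i := i) @` F)).
  by rewrite finite_setU; split; [exact: finite_set1|exact: finite_image].
exact: EF_sub (EF_component (h _ q fF')).
Qed.

Definition inclusion i (x : A i) : AP :=
  exist _ (sval x) (mem_set (ex_intro2 _ _ i Logic.I (set_mem (valP x)))).

Lemma inclusion_part i (x : A i) : part AP i (inclusion x).
Proof. by apply/part_combination; exact: set_mem (valP x). Qed.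

Lemma part_inclusion i (x : AP) : part AP i x -> exists x0 : A i, x = inclusion x0.
Proof.
move=> /part_combination hx; exists (exist _ (sval x) (mem_set hx)).
exact: val_inj.
Qed.

Lemma inclusion_inj i (x y : A i) : inclusion x = inclusion y -> x = y.
Proof. by move=> /(congr1 sval) e; apply: val_inj. Qed.

Lemma inclusion_rel i (s : symbol (LA i)) (t : 'I_(arity s) -> A i) :
  @rel (LA i) (A i) s t <->
  @rel LP AP (member_symbol s) (fun k => inclusion (t k)).
Proof.
rewrite /= interp_combination; split=> [[]//|h]; split=> //.
  by move=> k; exact: set_mem (valP (t k)).
exact: set_mem (valP s).
Qed.

Lemma component_combination i : isomorphic (A i) (component AP i).
Proof.
exists (fun x => exist _ (inclusion x) (mem_set (inclusion_part x))).
split; last by move=> s t; exact: inclusion_rel.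
apply: inj_surj_bijective => [x y /(congr1 sval)|y]; first exact: inclusion_inj.
have [x hx] := part_inclusion (set_mem (valP y)).
by exists x; apply: val_inj.
Qed.

Lemma model_component M i :
  models M (Th AP) -> models (component M i) (Th (A i)).
Proof.
move=> hM; apply: (models_Th_trans (isomorphic_models (component_combination i))).
exact: component_models.
Qed.

Lemma component_isomorphic M N i :
  isomorphic M N -> isomorphic (component M i) (component N i).
Proof.
move=> [f [[g fg gf] hf]].
have pf x : part M i x <-> part N i (f x) by exact: hf.
have pf' (x : component M i) : part N i (f (sval x)).
  by apply/pf; exact: set_mem (valP x).
exists (fun x => exist _ (f (sval x)) (mem_set (pf' x))); split; last first.
  by move=> s t; exact: (hf (member_symbol s)).
apply: inj_surj_bijective => [x y /(congr1 sval)/(can_inj fg)|y].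
  exact: val_inj.
have pg : part M i (g (sval y)) by apply/pf; rewrite gf; exact: set_mem (valP y).
by exists (exist _ (g (sval y)) (mem_set pg)); apply: val_inj => /=; rewrite gf.
Qed.

(** As [I] is finite, the theory says that the parts cover the model and that
    every tuple in a relation lies in a part whose language has the symbol;
    isomorphisms of the components can therefore be glued. *)
Lemma components_isomorphic M N : finite_set [set: I] ->
  models M (Th AP) -> models N (Th AP) ->
  (forall i, isomorphic (component M i) (component N i)) -> isomorphic M N.
Proof.
move=> fI hM hN hiso.
pose h i : component M i -> component N i := sval (cid (hiso i)).
have hbij i : bijective (h i) by rewrite /h; case: cid => ? [].
have hrel i s (t : 'I_(arity s) -> component M i) :
    rel t <-> rel (h i \o t) by rewrite /h; case: cid => ? [].
have [f hf] : exists f : M -> N, forall i (x : component M i),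
    f (sval x) = sval (h i x).
  suff /choice[f hf] x : exists y, forall i (x' : component M i),
      sval x' = x -> y = sval (h i x') by exists f => i x; exact: hf.
  have [i hi] := model_cover hM fI x.
  exists (sval (h i (exist _ x (mem_set hi)))) => j x' xx'.
  have ij : i = j.
    by apply: (model_disjoint hM hi); rewrite -xx'; exact: set_mem (valP x').
  by subst j; congr (sval (h i _)); apply: val_inj.
have fpart i x : part M i x -> part N i (f x).
  move=> hi; rewrite (hf i (exist _ x (mem_set hi))).
  exact: set_mem (valP (h i _)).
have fpart' i x : part N i (f x) -> part M i x.
  move=> hi; have [j hj] := model_cover hM fI x.
  by rewrite (model_disjoint hN hi (fpart j x hj)).
exists f; split; first apply: inj_surj_bijective => [x y xy|y].
- have [i hx] := model_cover hM fI x.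
  have hy : part M i y by apply: fpart'; rewrite -xy; exact: fpart.
  have [g hg _] := hbij i.
  pose x' : component M i := exist _ x (mem_set hx).
  pose y' : component M i := exist _ y (mem_set hy).
  have e : sval (h i x') = sval (h i y') by rewrite -!hf.
  by have /(can_inj hg)/(congr1 sval) := val_inj e.
- have [i hy] := model_cover hN fI y; have [g _ gh] := hbij i.
  exists (sval (g (exist _ y (mem_set hy)))); by rewrite hf gh.
- move=> s t.
  suff half i : s = predicate i \/ lang (A i) (sval s) ->
      (forall k, part M i (t k)) -> rel t <-> rel (f \o t).
    split=> ht.
      by have [i [hs hi]] := model_rel hM fI ht; apply/(half i hs hi).
    have [i [hs hi]] := model_rel hN fI ht; apply/(half i hs) => //.
    by move=> k; exact/fpart'/hi.
  case=> [si|si] hi.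
    subst s; rewrite (predicate_const (i := i) t) /comp /=.
    split=> _; [apply: (fpart i)|]; exact: hi.
  pose s' : symbol (LA i) := exist _ (sval s) (mem_set si).
  have ss' : s = member_symbol s' by apply: val_inj.
  move: t hi; rewrite ss' => t hi.
  have := hrel i s' (fun k => exist _ (t k) (mem_set (hi k))).
  have <- // : (fun k => sval (h i (exist _ (t k) (mem_set (hi k))))) = f \o t.
  by apply/funext => k; rewrite -hf.
Qed.

(** * Disjoint unions of models of the theories of the members *)

Definition disjoint_union (N : forall i, structure (LA i)) : structure LP :=
  @Structure LP {i : I & N i} (fun s t =>
    (exists i (h : lang (A i) (sval s)) (t' : 'I_(arity (sval s)) -> N i),
       t = (fun k => existT _ i (t' k)) /\
       @rel (LA i) (N i) (exist _ (sval s) (mem_set h)) t') \/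
    (exists i, s = predicate i /\ forall k, tag (t k) = i)).

Lemma existT_inj (J : Type) (X : J -> Type) j (x y : X j) :
  existT X j x = existT X j y -> x = y.
Proof.
move=> h; have := projT2_eq h.
by rewrite (Prop_irrelevance (projT1_eq h) erefl).
Qed.

Section DisjointUnion.
Variable N : forall i, structure (LA i).

Lemma disjoint_union_part i (x : disjoint_union N) :
  part (disjoint_union N) i x <-> tag x = i.
Proof.
have [Pinj _ Pnew _] := hP; rewrite /part /=; split=> [|h]; last by right; exists i.
case=> [[j [h _]]|[j [/(congr1 sval)/= /Pinj <-]]]; first by case: (Pnew i j).
by apply; exact: predicate_ord.
Qed.

Lemma atomic_disjoint_union F (R : AP -> disjoint_union N -> Prop) :
  (forall x y, R x y -> part AP (tag y) x) ->
  (forall i, atomic_agree [set s | F (member_symbol s)]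
    (fun (x : A i) (y : N i) => R (inclusion x) (existT _ i y))) ->
  atomic_agree F R.
Proof.
move=> hpart hat; split=> [x y x' y' h h'|s Fs t u h].
  have ii x1 : part AP (tag y) x1 -> part AP (tag y') x1 -> tag y = tag y'.
    exact: combination_disjoint.
  case: y y' h h' ii => i b [i' b'] /= h h' ii.
  have [[x0 hx] [x0' hx']] :=
    (part_inclusion (hpart _ _ h), part_inclusion (hpart _ _ h')).
  split=> [xx'|].
    have ei : i = i'.
      by apply: (ii x); [exact: (hpart _ _ h)|rewrite xx'; exact: (hpart _ _ h')].
    subst i'; congr existT; rewrite hx in h; rewrite hx' in h'.
    by apply/(((hat i).1 _ _ _ _ h h')); apply: inclusion_inj; rewrite -hx -hx'.
  move=> e; have /= ei := congr1 tag e; subst i'; have {}e := existT_inj e.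
  rewrite hx in h *; rewrite hx' in h' *; congr inclusion.
  exact/((hat i).1 _ _ _ _ h h').
have lift i (hs : lang (A i) (sval s)) (b : 'I_(arity s) -> N i) :
    u = (fun k => existT _ i (b k)) ->
    (forall k, part AP i (t k)) ->
    rel t <-> @rel (LA i) (N i) (exist _ (sval s) (mem_set hs)) b.
  move=> ub ti; pose s' : symbol (LA i) := exist _ (sval s) (mem_set hs).
  have ss' : s = member_symbol s' by apply: val_inj.
  have [t0 ht0] := choice (fun k => part_inclusion (ti k)).
  rewrite -((hat i).2 s' _ t0 b).
  - have -> : t = (fun k => inclusion (t0 k)) by apply/funext.
    by rewrite inclusion_rel; exact: iff_refl.
  - by rewrite /= -ss'.
  - by move=> k; rewrite -ht0; have := h k; rewrite ub.
split=> [ht|[[i [hs [b [ub hb]]]]|[i [si hi]]]].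
- have [i [hsi hi]] := combination_rel ht.
  have tagu k : tag (u k) = i.
    exact: combination_disjoint (hpart _ _ (h k)) (hi k).
  case: hsi => [si|hs]; first by right; exists i.
  left; exists i, hs.
  have /choice[b hb] k : exists b, u k = existT _ i b.
    by have := tagu k; case: (u k) => j b /= <-; exists b.
  have ub : u = (fun k => existT _ i (b k)) by apply/funext.
  by exists b; split=> //; apply/(lift i hs b ub hi).
- apply/(lift i hs b ub) => // k; have := hpart _ _ (h k).
  by rewrite ub.
- subst s; rewrite (predicate_const (i := i) t).
  by have := hpart _ _ (h (predicate_ord i)); rewrite hi.
Qed.

(** The strategies for the members are played side by side. *)
Lemma EF_disjoint_union F q (R : AP -> disjoint_union N -> Prop) :
  (forall x y, R x y -> part AP (tag y) x) ->
  (forall i, EF [set s | F (member_symbol s)] q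
    (fun (x : A i) (y : N i) => R (inclusion x) (existT _ i y))) ->
  EF F q R.
Proof.
elim: q R => [|q IH] R hpart hE.
  by split=> //; apply: atomic_disjoint_union => // i; exact: EF_atomic (hE i).
split; first by apply: atomic_disjoint_union => // i; exact: EF_atomic (hE i).
have move_to i (a : A i) (b : N i) :
    EF [set s | F (member_symbol s)] q
      (extend (fun (x : A i) (y : N i) => R (inclusion x) (existT _ i y)) a b) ->
    EF F q (extend R (inclusion a) (existT _ i b)).
  move=> hab; apply: IH => [x y [/hpart//|[-> ->]]|j]; first exact: inclusion_part.
  have [ij|ij] := pselect (i = j).
    subst j; apply: EF_sub hab => // x y [h|[ex ey]]; first by left.
    by right; split; [exact: inclusion_inj ex|exact: existT_inj ey].
  apply: EF_sub (EF_leq (leqnSn q) (hE j)) => // x y [//|[_ e]].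
  by case: ij; have /= := congr1 tag e.
split=> [a|[i b]].
- have [i /part_inclusion[a0 ->]] := combination_cover a.
  have [_ [h1 _]] := hE i; have [b hb] := h1 a0.
  by exists (existT _ i b); exact: move_to.
- have [_ [_ h2]] := hE i; have [a ha] := h2 b.
  by exists (inclusion a); exact: move_to.
Qed.

Hypothesis hN : forall i, models (N i) (Th (A i)).

(** The theory of a disjoint union depends only on those of its members. *)
Lemma disjoint_union_models : models (disjoint_union N) (Th AP).
Proof.
apply/models_Th_EF => F q fF; apply: EF_disjoint_union => // i.
have fFi : finite_set [set s : symbol (LA i) | F (member_symbol s)].
  apply: (finite_preimage (f := @member_symbol i)) => // s s' _ _.
  by move=> /(congr1 sval) e; exact: val_inj.
have /models_Th_EF/(_ _ q fFi) h := @hN i.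
by apply: EF_sub h.
Qed.

(** The languages of the members may overlap. Tuples with an entry in [N i] are
    not affected; for nullary symbols the agreement of the members is needed, and
    it comes from the combination. *)
Lemma component_disjoint_union i :
  isomorphic (N i) (component (disjoint_union N) i).
Proof.
have hpart (x : N i) : part (disjoint_union N) i (existT _ i x).
  exact/disjoint_union_part.
exists (fun x => exist _ (existT _ i x) (mem_set (hpart x))); split.
  apply: inj_surj_bijective => [x y e|[[j y] hj]].
    exact: existT_inj (congr1 sval e).
  have /= ji := (disjoint_union_part _ _).1 (set_mem hj); subst j.
  by exists y; apply: val_inj.
move=> s t; split=> [ht|ht].
  left; exists i, (set_mem (valP s)), t; split=> //.
  case: s t ht => s hs t /= ht.
  by rewrite (bool_irrelevance (mem_set _) hs).
have [[k0 _]|hk] := pselect (exists k : 'I_(arity s), True); last first.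
  (* a nullary symbol is interpreted as in [A i], in the union and in [N i] *)
  have h : models (component (disjoint_union N) i) (Th (N i)).
    apply: models_Th_trans (models_Th_sym (@hN i)) _.
    exact/model_component/disjoint_union_models.
  have [_ hr] := EF_atomic ((models_Th_EF _ _).1 h _ 0%N (finite_set1 s)).
  apply/(hr s erefl t
    (fun k => exist _ (existT _ i (t k)) (mem_set (hpart (t k))))); last exact: ht.
  by move=> k; case: hk; exists k.
case: ht => [[j [hs [t' [tt' ht']]]]|[j [/(congr1 sval)/= sj _]]].
  have ji : i = j by have := congr1 (fun u => tag (u k0)) tt'.
  subst j; have -> : t = t'.
    apply/funext => k; apply: (@existT_inj I N i).
    exact: (congr1 (fun u => u k) tt').
  case: s t t' hs {k0 tt'} ht' => s hs t t' hs' /=.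
  by rewrite (bool_irrelevance (mem_set _) hs).
by have [_ _ /(_ j i)] := hP; rewrite -sj => -[]; exact: set_mem (valP s).
Qed.

Lemma disjoint_union_countable : finite_set [set: I] ->
  (forall i, countable [set: N i]) -> countable [set: disjoint_union N].
Proof.
move=> /finite_set_countable/countable_injP[f finj] cN.
have [g hg] : exists g : forall i, N i -> nat, forall i, injective (g i).
  have h i : exists g : N i -> nat, injective g.
    have /countable_injP[g hg] := cN i.
    by exists g => x y; apply: hg; rewrite inE.
  by exists (fun i => sval (cid (h i))) => i; case: cid.
apply/countable_injP; exists (fun x => pickle (f (tag x), g _ (tagged x))).
move=> [i x] [j y] _ _ /(pcan_inj pickleK)[/= /finj]; rewrite !inE.
by move=> /(_ Logic.I Logic.I) ij; subst j => /hg ->.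
Qed.

End DisjointUnion.

Lemma disjoint_union_isomorphic (N N' : forall i, structure (LA i)) i :
  (forall j, models (N j) (Th (A j))) -> (forall j, models (N' j) (Th (A j))) ->
  isomorphic (disjoint_union N) (disjoint_union N') -> isomorphic (N i) (N' i).
Proof.
move=> hN hN' /component_isomorphic-/(_ i) h.
apply: isomorphic_trans (component_disjoint_union hN i) _.
exact: isomorphic_trans h (isomorphic_sym (component_disjoint_union hN' i)).
Qed.

(** * Counting the models of the combination *)

Hypothesis hlang : forall i, countable (lang (A i)).
Hypothesis hinf : infinite_set (univ AP).

Lemma countable_member_symbols i : countable [set: symbol (LA i)].
Proof. by rewrite /= (eq_countable (card_setT (lang (A i)))). Qed.

Lemma infinite_carrier (B : setstructure S U) :
  infinite_set (univ B) <-> infinite_set [set: B].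
Proof. by rewrite /= (eq_finite_set (card_setT (univ B))). Qed.

Lemma countable_index (M : structure LP) :
  models M (Th AP) -> countable [set: M] -> countable [set: I].
Proof.
move=> hM /countable_injP[f finj]; have [x hx] := choice (model_nonempty hM).
apply/countable_injP; exists (fun i => f (x i)) => i j _ _ /finj.
rewrite !inE => /(_ Logic.I Logic.I) e.
by apply: (model_disjoint hM (hx i)); rewrite e.
Qed.

Lemma countable_combination_symbols :
  countable [set: I] -> countable [set: symbol LP].
Proof.
move=> cI; rewrite /= (eq_countable (card_setT (lang AP))).
have -> : lang AP = \bigcup_(b : bool)
    (if b then \bigcup_i lang (A i) else range P).
  apply/seteqP; split=> [s [h|h]|s [[] _ h]]; [by exists true|by exists false| |].
    by left.
  by right.
apply: bigcup_countable => [|[] _]; first exact: countableP.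
  by apply: bigcup_countable => // i _; exact: hlang.
exact: sub_countable (card_image_le _ _) cI.
Qed.

(** If [I] is infinite, there is no countable model or there are infinitely
    many. *)
Lemma Ehrenfeucht_finite_index : Ehrenfeucht AP -> finite_set [set: I].
Proof.
move=> /Ehrenfeucht_theoryP[fT [M [_ [[hM cM _] _ _]]]].
apply: contrapT => /infiniteP iI.
have cL := countable_combination_symbols (countable_index hM cM).
have [N [hN Ninj]] := infinitely_many_models hinf cL iI.
exact: many_models_not_finite hN Ninj fT.
Qed.

Section FiniteIndex.
Hypothesis fI : finite_set [set: I].

Lemma component_countable_model M i : infinite_set [set: A i] ->
  countable_model (Th AP) M -> countable_model (Th (A i)) (component M i).
Proof.
move=> iA [hM cM _]; have hMi := @model_component M i hM; split=> //.
  rewrite /= (eq_countable (card_setT (part M i))).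
  by apply: sub_countable cM; apply: subset_card_le.
by move=> /(models_finite hMi).
Qed.

Lemma component_finite M N i : finite_set [set: A i] ->
  models M (Th AP) -> models N (Th AP) ->
  isomorphic (component M i) (component N i).
Proof.
move=> fA hM hN.
apply: isomorphic_trans (isomorphic_sym _)
  (finite_models_isomorphic fA (@model_component N i hN)).
exact: finite_models_isomorphic fA (@model_component M i hM).
Qed.

Lemma disjoint_union_countable_model (N : forall i, structure (LA i)) :
  (forall i, models (N i) (Th (A i)) /\ countable [set: N i]) ->
  countable_model (Th AP) (disjoint_union N).
Proof.
move=> hN; have hU : models (disjoint_union N) (Th AP).
  by apply: disjoint_union_models => i; case: (hN i).
split=> //; first by apply: disjoint_union_countable => // i; case: (hN i).
by move=> /(models_finite hU); exact/infinite_carrier.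
Qed.

(** Extends [N] to a model of the theory of the combination, through
    [disjoint_union]. The family is built by cases on [i = j], whence the
    transport along [e]. *)
Lemma prescribed_family i (N : structure (LA i)) :
  models N (Th (A i)) -> countable [set: N] ->
  exists B : forall j, structure (LA j),
    B i = N /\ forall j, models (B j) (Th (A j)) /\ countable [set: B j].
Proof.
move=> hN cN.
have hB j : exists B : structure (LA j), (forall e : i = j,
    B = eq_rect i (fun j => structure (LA j)) N j e) /\
    models B (Th (A j)) /\ countable [set: B].
  have [ij|ij] := pselect (i = j).
    subst j; exists N; split=> // e.
    by rewrite (Prop_irrelevance e erefl).
  have [B hB] := countable_model_exists (A j) (@countable_member_symbols j).
  by exists B.
exists (fun j => sval (cid (hB j))); split=> [|j]; case: cid => B [] //=.
by move=> /(_ erefl).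
Qed.

(** A model of the theory of [A i] is a component of a model of the theory of the
    combination, and can be recovered from it up to isomorphism. *)
Lemma finitely_many_members i : infinite_set [set: A i] ->
  finitely_many_models (Th AP) -> finitely_many_models (Th (A i)).
Proof.
move=> iA [K [c hc]].
have [g hg] : exists g : structure (LA i) -> structure LP,
    forall N : structure (LA i), countable_model (Th (A i)) N ->
    exists B, [/\ g N = disjoint_union B, B i = N
      & forall j, models (B j) (Th (A j)) /\ countable [set: B j]].
  suff /choice[g hg] (N : structure (LA i)) : exists M, countable_model (Th (A i)) N ->
    exists B, [/\ M = disjoint_union B, B i = N
      & forall j, models (B j) (Th (A j)) /\ countable [set: B j]] by exists g.
  have [[hN cN _]|hN] := pselect (countable_model (Th (A i)) N).
    have [B [BN hB]] := prescribed_family hN cN.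
    by exists (disjoint_union B) => _; exists B.
  by exists AP.
exists K, (c \o g) => N1 N2 cN cN' /=.
have [[B [-> <- hB]] [B' [-> <- hB']]] := (hg _ cN, hg _ cN').
move=> /(hc _ _ (disjoint_union_countable_model hB)
           (disjoint_union_countable_model hB')).
by apply: disjoint_union_isomorphic => j; [case: (hB j)|case: (hB' j)].
Qed.

(** The invariants of the components, taken together, are an invariant of the
    model with finitely many values. *)
Lemma finitely_many_combination :
  (forall i, infinite_set [set: A i] -> finitely_many_models (Th (A i))) ->
  finitely_many_models (Th AP).
Proof.
move=> hA.
have hK i : exists (K : finType) (c : structure (LA i) -> K), forall M N,
    countable_model (Th AP) M -> countable_model (Th AP) N ->
    c (component M i) = c (component N i) ->
    isomorphic (component M i) (component N i).
  have [fA|iA] := pselect (finite_set [set: A i]).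
    exists unit, (fun=> tt) => M N [hM _ _] [hN _ _] _.
    exact: component_finite.
  have [K [c hc]] := hA i iA.
  by exists K, c => M N cM cN; apply: hc; exact: component_countable_model.
pose K i := sval (cid (hK i)).
pose c i : structure (LA i) -> K i := sval (cid (svalP (cid (hK i)))).
have hc i : forall M N, countable_model (Th AP) M -> countable_model (Th AP) N ->
    c i (component M i) = c i (component N i) ->
    isomorphic (component M i) (component N i).
  exact: (svalP (cid (svalP (cid (hK i))))).
have [m [f hf]] := finite_set_enum fI.
exists {dffun forall k : 'I_m, K (f k)},
  (fun M => [ffun k => c (f k) (component M (f k))]) => M N cM cN /ffunP h.
have [[hM _ _] [hN _ _]] := (cM, cN).
apply: components_isomorphic => // i; have [k <-] := hf i Logic.I.
by apply: hc => //; have := h k; rewrite !ffunE.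
Qed.

(** Two non-isomorphic models have non-isomorphic components at some [i]; then
    [A i] is neither finite nor omega-categorical. *)
Lemma Ehrenfeucht_member : Ehrenfeucht AP ->
  (forall i, infinite_set [set: A i] -> omega_categorical (A i) \/ Ehrenfeucht (A i)) ->
  exists i, Ehrenfeucht (A i).
Proof.
move=> /Ehrenfeucht_theoryP[_ [M [N [cM cN hMN]]]] hA.
apply: contrapT => hno; apply: hMN.
have [[hM _ _] [hN _ _]] := (cM, cN); apply: components_isomorphic => // i.
have [fA|iA] := pselect (finite_set [set: A i]); first exact: component_finite.
have [[_ /omega_categorical_theoryP[_ h]]|h] := hA i iA; last by case: hno; exists i.
by apply: h; exact: component_countable_model.
Qed.

Lemma Ehrenfeucht_combination :
  (forall i, infinite_set [set: A i] -> finitely_many_models (Th (A i))) ->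
  (exists i, Ehrenfeucht (A i)) -> Ehrenfeucht AP.
Proof.
move=> hA [i /Ehrenfeucht_theoryP[_ [N [N' [[hN cN _] [hN' cN' _] hNN']]]]].
apply/Ehrenfeucht_theoryP; split; first exact: finitely_many_combination.
have [[B [BN hB]] [B' [BN' hB']]] :=
  (prescribed_family hN cN, prescribed_family hN' cN').
exists (disjoint_union B), (disjoint_union B').
split; [exact: disjoint_union_countable_model..|] => h; apply: hNN'.
rewrite -BN -BN'; apply: disjoint_union_isomorphic h => j.
  by case: (hB j).
by case: (hB' j).
Qed.

End FiniteIndex.
End Combination.

Theorem theorem2p3 (S : signature) (U I : Type) (P : I -> symbol S)
    (A : I -> setstructure S U)
    (hP : universe_predicates P A)
    (hcomb : is_P_combination P A)
    (hdisj : trivIset [set: I] (fun i => univ (A i)))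
    (hlang : forall i, countable (lang (A i)))
    (hinf : infinite_set (univ (P_union P A))) :
  Ehrenfeucht (P_union P A) <->
  [/\ finite_set [set: I],
      forall i, finite_set (univ (A i)) \/ omega_categorical (A i) \/
                Ehrenfeucht (A i)
    & exists i, Ehrenfeucht (A i)].
Proof.
split=> [hE|[fI hA exE]].
  have fI : finite_set [set: I] by apply: Ehrenfeucht_finite_index hE.
  have hA i : infinite_set [set: A i] -> omega_categorical (A i) \/ Ehrenfeucht (A i).
    move=> iA; apply: finitely_many_Th => //; first exact: countable_member_symbols.
    have /Ehrenfeucht_theoryP[fT _] := hE.
    by apply: finitely_many_members fT.
  split=> //; last by apply: Ehrenfeucht_member hE hA.
  move=> i; have [?|/infinite_carrier iA] := pselect (finite_set (univ (A i))).
    by left.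
  by right; exact: hA.
apply: Ehrenfeucht_combination => // i iA.
apply: omega_categorical_or_Ehrenfeucht_finitely_many.
by case: (hA i) => // fA; case/infinite_carrier: iA.
Qed.
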